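(* Let $n,p,S$ be positive integers with $S\le p$ and $p\ge 2$, let $R\ge 0$ and $\sigma>0$ ($\sigma$ known), and let $X$ be a real $n\times p$ matrix each of whose columns satisfies $\|X_i\|_{\ell_2}^2=n$. Put $\widetilde X=\frac1{\sqrt n}X$, $\delta=\delta_{2S}(\widetilde X)$ and $\theta=\theta_{S,2S}(\widetilde X)$, and assume $\delta+\theta<1$. Suppose $\beta^0\in\mathcal P=\mathcal P_{S,R}$ and that $\Pi$ is an arbitrary prior (probability measure) on $\mathbb R^p$. Let $\alpha>0$ and $\tau>0$ satisfy $0<1+\tau<\alpha$, and let $$\varepsilon=\frac{8\sigma}{1-\delta-\theta}\sqrt{\frac{(1+\alpha)S\log p}{n}}+2\,\frac{1-\delta+\theta}{1-\delta-\theta}\,\frac{R}{\sqrt S},\qquad C_\tau=\frac13\sqrt{\frac{2\sigma^2(1+\tau)\log p}{n}}.$$ Then $$\mathbb E_{\beta^0}\Pi\big(B^{\ell_2}_{2\varepsilon}(\beta^0)^c\mid y\big)\le \frac1{p^\alpha\sqrt{\pi\log p}}+\frac{p^{1+\tau}\,\Pi\big(B^{\ell_2}_{2\varepsilon}(\beta^0)^c\setminus\mathcal P\big)}{\Pi\big(B^{\ell_1}_{C_\tau}(\beta^0)\big)}+\frac{p^{1+\tau}}{p^\alpha\sqrt{\pi\log p}\;\Pi\big(B^{\ell_1}_{C_\tau}(\beta^0)\big)}+\frac1{p^\tau\sqrt{\pi\log p}}.$$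
   Context: Model: $y=X\beta^0+e$ with $e\sim\mathcal N(0,\sigma^2I_n)$; $\mathbb E_{\beta}$ denotes expectation over $y$ when $y\sim\mathcal N(X\beta,\sigma^2 I_n)$. The likelihood is $f(y\mid\beta)=(2\pi\sigma^2)^{-n/2}\exp\{-\|y-X\beta\|_{\ell_2}^2/2\sigma^2\}$ and the posterior is $\Pi(U\mid y)=\int_U f(y\mid\beta)\,d\Pi(\beta)\big/\int_{\mathbb R^p} f(y\mid\beta)\,d\Pi(\beta)$ for Borel $U\subset\mathbb R^p$. $\|b\|_{\ell_0}$ is the number of nonzero entries of $b$. $\sigma_S(\beta)=\inf_{\|b\|_{\ell_0}\le S}\|\beta-b\|_{\ell_1}$ and $\mathcal P_{S,R}=\{\beta\in\mathbb R^p:\sigma_S(\beta)\le R\}$. $B^{\ell_u}_r(\beta)=\{x\in\mathbb R^p:\|x-\beta\|_{\ell_u}<r\}$, and $U^c$ is the complement of $U$. $\delta_k(\widetilde X)$ (restricted isometry constant) is the smallest constant with $(1-\delta_k)\|b\|_{\ell_2}^2\le\|\widetilde Xb\|_{\ell_2}^2\le(1+\delta_k)\|b\|_{\ell_2}^2$ for all $b\in\mathbb R^p$ with $\|b\|_{\ell_0}\le k$. $\theta_{k,k'}(\widetilde X)$ (restricted orthogonality constant) is the smallest constant with $|\langle\widetilde X_Tb,\widetilde X_{T'}b'\rangle|\le\theta_{k,k'}\|b\|_{\ell_2}\|b'\|_{\ell_2}$ for all vectors $b,b'$ and all disjoint $T,T'\subset\{1,\dots,p\}$ with $|T|\le k$,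 $|T'|\le k'$, $|T|+|T'|\le p$, where $\widetilde X_T$ is the submatrix of columns of $\widetilde X$ with indices in $T$. If $\Pi(B^{\ell_1}_{C_\tau}(\beta^0))=0$, the right-hand side of the inequality is read as $+\infty$. *)

(* Defs.v *)
From HB Require Import structures.
From mathcomp Require Import all_boot all_order all_algebra.
From mathcomp Require Import all_classical all_reals all_analysis.

Set Implicit Arguments.
Unset Strict Implicit.
Unset Printing Implicit Defensive.

Import Order.TTheory GRing.Theory Num.Theory.
Import numFieldNormedType.Exports.

Local Open Scope classical_set_scope.
Local Open Scope ring_scope.

Section vectors.
Context {R : realType}.
Implicit Types p : nat.

Definition l0norm p (b : 'cV[R]_p) : nat := #|[pred i | b i 0 != 0]|.

Definition l1norm p (b : 'cV[R]_p) : R := \sum_i `|b i 0|.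

Definition l2norm p (b : 'cV[R]_p) : R := Num.sqrt (\sum_i b i 0 ^+ 2).

Definition inner p (u v : 'cV[R]_p) : R := \sum_i u i 0 * v i 0.

(* The library's norm and [ball] on matrices are those of the sup norm; the
   norm is therefore a parameter here. *)
Definition normball p (N : 'cV[R]_p -> R) (b : 'cV[R]_p) (r : R) :
    set 'cV[R]_p :=
  [set x | N (x - b) < r].

Definition best_approx p (S : nat) (b : 'cV[R]_p) : R :=
  inf [set l1norm (b - c) | c in [set c : 'cV[R]_p | (l0norm c <= S)%N]].

Definition approx_sparse p (S : nat) (r : R) : set 'cV[R]_p :=
  [set b | best_approx S b <= r].

End vectors.

Section restricted_constants.
Context {R : realType} (n p : nat).
Implicit Types M : 'M[R]_(n, p).

Definition RIP_bound k M (c : R) : Prop :=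
  forall b : 'cV[R]_p, (l0norm b <= k)%N ->
    (1 - c) * l2norm b ^+ 2 <= l2norm (M *m b) ^+ 2 /\
    l2norm (M *m b) ^+ 2 <= (1 + c) * l2norm b ^+ 2.

(* For 0 < k and 0 < p the admissible constants form a nonempty closed set
   bounded below by 0, so this infimum is the smallest of them. *)
Definition RIC k M : R := inf [set c | RIP_bound k M c].

Definition colsubmx M (T : {set 'I_p}) : 'M[R]_(n, #|T|) :=
  colsub (fun j : 'I_#|T| => enum_val j) M.

Definition ROP_bound k k' M (c : R) : Prop :=
  forall T T' : {set 'I_p}, (T :&: T')%SET = finset.set0 ->
    (#|T| <= k)%N -> (#|T'| <= k')%N -> (#|T| + #|T'| <= p)%N ->
  forall (b : 'cV[R]_#|T|) (b' : 'cV[R]_#|T'|),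
    `|inner (colsubmx M T *m b) (colsubmx M T' *m b')|
      <= c * l2norm b * l2norm b'.

(* Again a minimum, as soon as 0 < k, 0 < k' and 1 < p. *)
Definition ROC k k' M : R := inf [set c | ROP_bound k k' M c].

End restricted_constants.

Section product_power.
Context d (T : measurableType d) (R : realType).

Definition cons_pair n (x : T * n.-tuple T) : n.+1.-tuple T :=
  [the n.+1.-tuple T of x.1 :: x.2].

Lemma measurable_cons_pair n : measurable_fun setT (@cons_pair n).
Proof. exact: measurable_cons. Qed.

HB.instance Definition _ n :=
  isMeasurableFun.Build _ _ _ _ (@cons_pair n) (@measurable_cons_pair n).

(* The n-fold product of P with itself, i.e. the law of n independent draws
   from P. *)
Fixpoint prob_power (P : probability T R) (n : nat) :
    probability (n.-tuple T) R :=
  match n with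
  | 0 => \d_([tuple] : 0.-tuple T)
  | n'.+1 => distribution (P \x prob_power P n')%E (@cons_pair n')
  end.

End product_power.

(* R^p with the Borel sigma-algebra of its product topology. *)
Notation borel_cV R p := (g_sigma_algebraType (@open 'cV[R]_p)).

Section bayesian_linear_model.
Context {R : realType} (n p : nat).
Variables (X : 'M[R]_(n, p)) (s : R).

(* The expectation of g y for y ~ N(X b, s^2 I_n), i.e. y = X b + e where the
   coordinates of e are independent N(0, s^2) variables. *)
Definition model_expectation (b : 'cV[R]_p) (g : 'cV[R]_n -> \bar R) : \bar R :=
  (\int[prob_power (normal_prob 0 s) n]_e g (X *m b + \col_i (tnth e i : R))%R)%E.

Definition likelihood (y : 'cV[R]_n) (b : 'cV[R]_p) : R :=
  (2 * pi * s ^+ 2) `^ (- (n%:R / 2))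
  * expR (- (l2norm (y - X *m b) ^+ 2 / (2 * s ^+ 2))).

(* The denominator is always positive and finite when s != 0. *)
Definition posterior (Pi : probability (borel_cV R p) R) (y : 'cV[R]_n)
    (U : set 'cV[R]_p) : \bar R :=
  (\int[Pi]_(b in U) (likelihood y b)%:E / \int[Pi]_b (likelihood y b)%:E)%E.

End bayesian_linear_model.

(* Main.v *)
From HB Require Import structures.
Require Import Defs.
From mathcomp Require Import all_boot all_order all_algebra.
From mathcomp Require Import all_classical all_reals all_analysis.
From mathcomp Require Import measurable_realfun.
From mathcomp Require Import ring lra zify.

(** Write h = b - beta0, let e be the noise, and for k > 0 let lam k be
    4/3 * sigma * sqrt (2 n (1 + k) ln p).  Call the noise k-good when all the
    correlations of e with the columns of X are at most lam k in absolute
    value.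

    Probability.  Under N(0, sigma^2 I_n) the noise fails to be k-good with
    probability at most 1 / (p^k sqrt (pi ln p)) ([noise_max_corr]).  A single
    correlation exceeds l with probability at most
    exp (- l^2 / (2 sigma^2 n)): translating the Gaussian measure by the
    multiple of the column that moves the slab of level l to level 0 costs
    at most this factor ([noise_slab]).  The union bound over the p columns and
    the square root of ln p are then absorbed by the constant 4/3, since
    sqrt (pi L) <= exp (7/9 L).

    Small l1 balls.  If e is tau-good, the likelihood at any b in the l1 ball of
    radius C around beta0 is at least p^-(1 + tau) times the likelihood at beta0
    ([lratio_lower]): the linear term of the log-likelihood ratio accounts for
    8/9 and the quadratic one for 1/9 of (1 + tau) ln p.  Hence on this event
    the posterior mass of the far set is at most p^(1 + tau) / Pi(ball) times
    the prior integral of the likelihood ratio ([posterior_le_lratio]).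

    Change of measure.  Averaging the likelihood ratio at b over tau-good noise
    gives, by Tonelli and the Gaussian translation formula ([noise_translate]),
    the probability that e + X h is tau-good ([expected_lratio]).  This is at
    most 1, which is used for b outside the sparse class.  For b in the sparse
    class and far from beta0 it is at most the probability that e is not
    alpha-good: were e alpha-good and e + X h tau-good, all the correlations of
    X h with the columns would be at most lam tau + lam alpha.

    Stability.  Such small correlations force h to be small in l2
    ([sparse_diff_close]).  Of b and beta0, the one with the smaller l1 norm is
    obtained from the other without increasing the l1 norm, so h satisfies the
    cone condition of the Dantzig selector ([sparse_diff_cone]); the restricted
    isometry and orthogonality constants then bound h by the standard block
    decomposition ([cone_stability]).

    Adding the probability that e is not tau-good, where the posterior mass is
    at most 1, gives the second, third and fourth terms of the bound
    ([expected_posterior_le]). *)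

Set Implicit Arguments.
Unset Strict Implicit.
Unset Printing Implicit Defensive.

Import Order.TTheory GRing.Theory Num.Theory.
Import numFieldNormedType.Exports.

Local Open Scope classical_set_scope.
Local Open Scope ring_scope.

(** * Euclidean norm and restricted constants *)

Section l2norm_theory.
Context {R : realType}.
Implicit Types (p : nat).

Lemma sum_cauchy_schwarz (I : finType) (A : {set I}) (u v : I -> R) :
  (\sum_(i in A) u i * v i) ^+ 2 <=
  (\sum_(i in A) u i ^+ 2) * (\sum_(i in A) v i ^+ 2).
Proof.
set U := \sum_(i in A) u i ^+ 2; set V := \sum_(i in A) v i ^+ 2.
set W := \sum_(i in A) u i * v i.
(* Lagrange's identity *)
have : 0 <= \sum_(i in A) \sum_(j in A) (u i * v j - u j * v i) ^+ 2.
  by apply: sumr_ge0 => i _; apply: sumr_ge0 => j _; exact: sqr_ge0.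
have -> : \sum_(i in A) \sum_(j in A) (u i * v j - u j * v i) ^+ 2 =
    U * V + V * U - 2 * (W * W).
  rewrite /U /V /W !big_distrlr/= mulr_sumr -big_split -sumrB/=.
  apply: eq_bigr => i _; rewrite mulr_sumr -big_split -sumrB/=.
  by apply: eq_bigr => j _; ring.
by rewrite expr2; lra.
Qed.

Lemma l2norm_ge0 p (b : 'cV[R]_p) : 0 <= l2norm b.
Proof. exact: sqrtr_ge0. Qed.

Lemma sqr_l2norm p (b : 'cV[R]_p) : l2norm b ^+ 2 = \sum_i b i 0 ^+ 2.
Proof. by rewrite sqr_sqrtr// sumr_ge0// => i _; exact: sqr_ge0. Qed.

Lemma sqr_l2normE p (b : 'cV[R]_p) : l2norm b ^+ 2 = inner b b.
Proof. by rewrite sqr_l2norm; apply: eq_bigr => i _; rewrite expr2. Qed.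

Lemma innerDr p (u v w : 'cV[R]_p) : inner u (v + w) = inner u v + inner u w.
Proof.
by rewrite -big_split; apply: eq_bigr => i _; rewrite mxE mulrDr.
Qed.

Lemma innerC p (u v : 'cV[R]_p) : inner u v = inner v u.
Proof. by apply: eq_bigr => i _; rewrite mulrC. Qed.

Lemma inner_trmx n p (M : 'M[R]_(n, p)) u v :
  inner (M *m u) v = inner u (M^T *m v).
Proof.
rewrite /inner.
under eq_bigr do rewrite mxE mulr_suml.
rewrite exchange_big/=; apply: eq_bigr => j _.
rewrite mxE mulr_sumr; apply: eq_bigr => i _.
by rewrite mxE; ring.
Qed.

Lemma inner_le_l2norm p (u v : 'cV[R]_p) :
  `|inner u v| <= l2norm u * l2norm v.
Proof.
rewrite -ler_sqr ?nnegrE ?mulr_ge0 ?l2norm_ge0// exprMn !sqr_l2norm real_normK ?num_real//.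
have := sum_cauchy_schwarz [set: 'I_p]%SET (fun i => u i 0) (fun i => v i 0).
by rewrite /inner; under eq_bigl do rewrite inE; under [X in _ <= X * _]eq_bigl do rewrite inE;
  under [X in _ <= _ * X]eq_bigl do rewrite inE.
Qed.

Lemma ler_l2normD p (u v : 'cV[R]_p) : l2norm (u + v) <= l2norm u + l2norm v.
Proof.
rewrite -ler_sqr ?nnegrE ?addr_ge0 ?l2norm_ge0// sqrrD !sqr_l2normE.
rewrite innerDr !(innerC (u + v)) !innerDr (innerC v u).
have := inner_le_l2norm u v; have := ler_norm (inner u v); lra.
Qed.

(** Row by row, this is the Cauchy-Schwarz inequality: the Frobenius norm
    dominates the operator norm. *)
Lemma sqr_l2norm_mulmx n p (M : 'M[R]_(n, p)) b :
  l2norm (M *m b) ^+ 2 <= (\sum_i \sum_j M i j ^+ 2) * l2norm b ^+ 2.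
Proof.
rewrite !sqr_l2norm mulr_suml; apply: ler_sum => i _.
have := sum_cauchy_schwarz [set: 'I_p]%SET (fun j => M i j) (fun j => b j 0).
rewrite mxE; under eq_bigl do rewrite inE; under [X in _ <= X * _]eq_bigl do rewrite inE.
by under [X in _ <= _ * X]eq_bigl do rewrite inE.
Qed.

End l2norm_theory.

Section restricted_constants_theory.
Context {R : realType} (n p : nat).
Implicit Types (M : 'M[R]_(n, p)) (A B T : {set 'I_p}) (h : 'cV[R]_p).

Definition restr A h : 'cV[R]_p := \col_i (if i \in A then h i 0 else 0).

Lemma l0norm_restr A h : (l0norm (restr A h) <= #|A|)%N.
Proof.
apply: subset_leq_card; apply/fintype.subsetP => i; rewrite inE mxE.
by case: ifP => // _; rewrite eqxx.
Qed.

Lemma sqr_l2norm_restr A h : l2norm (restr A h) ^+ 2 = \sum_(i in A) h i 0 ^+ 2.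
Proof.
rewrite sqr_l2norm [RHS]big_mkcond; apply: eq_bigr => i _; rewrite mxE.
by case: ifP => // _; rewrite expr0n.
Qed.

Lemma restrU A B h : (A :&: B)%SET = finset.set0 ->
  restr (A :|: B)%SET h = restr A h + restr B h.
Proof.
move=> AB; apply/colP => i; rewrite !mxE finset.in_setU.
have [iA|iA] := boolP (i \in A); last by rewrite add0r.
by have := finset.in_setI i A B; rewrite AB inE iA => /esym/= ->; rewrite addr0.
Qed.

Lemma restr_setC A h : h = restr A h + restr (~: A)%SET h.
Proof.
apply/colP => i; rewrite !mxE finset.in_setC.
by case: ifP => _; rewrite ?addr0 ?add0r.
Qed.

Lemma inner_restr A h v : inner (restr A h) v = \sum_(i in A) h i 0 * v i 0.
Proof.
rewrite [RHS]big_mkcond; apply: eq_bigr => i _; rewrite mxE.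
by case: ifP => // _; rewrite mul0r.
Qed.

(** The infimum defining [RIC] is attained, since the inequality can be passed to
    the infimum for each b separately. *)
Lemma RIC_lower k M b : (l0norm b <= k)%N ->
  (1 - RIC k M) * l2norm b ^+ 2 <= l2norm (M *m b) ^+ 2.
Proof.
move=> bk; have [b0|b0] := eqVneq (l2norm b ^+ 2) 0.
  by rewrite b0 mulr0 sqr_ge0.
have {}b0 : 0 < l2norm b ^+ 2 by rewrite lt0r b0 sqr_ge0.
rewrite -ler_pdivlMr// lerBlDr -lerBlDl; apply: lb_le_inf.
  exists (1 + \sum_i \sum_j M i j ^+ 2) => c _; split.
    rewrite (@le_trans _ _ 0) ?sqr_ge0// mulr_le0_ge0 ?sqr_ge0//.
    by rewrite subr_le0 lerDl sumr_ge0// => i _; rewrite sumr_ge0// => j _; exact: sqr_ge0.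
  apply: (le_trans (sqr_l2norm_mulmx _ _)); rewrite ler_wpM2r ?sqr_ge0//.
  by lra.
by move=> c /(_ b bk) [cb _]; rewrite lerBlDl -lerBlDr ler_pdivlMr.
Qed.

Lemma colsubmx_restr M T h :
  colsubmx M T *m (\col_j h (enum_val j) 0) = M *m restr T h.
Proof.
apply/colP => i; rewrite !mxE.
rewrite (eq_bigr (fun j => M i (enum_val j) * h (enum_val j) 0)); last first.
  by move=> j _; rewrite !mxE.
rewrite -(big_enum_val (fun j => M i j * h j 0)) big_mkcond; apply: eq_bigr => j _.
by rewrite mxE; case: ifP => // _; rewrite mulr0.
Qed.

Lemma l2norm_enum_val T h :
  l2norm (\col_(j < #|T|) h (enum_val j) 0) = l2norm (restr T h).
Proof.
rewrite /l2norm; congr Num.sqrt.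
under eq_bigr do rewrite mxE.
rewrite -(big_enum_val (fun j => h j 0 ^+ 2)) big_mkcond; apply: eq_bigr => j _.
by rewrite mxE; case: ifP => // _; rewrite expr0n.
Qed.

Lemma colsubmx_bound M T (b : 'cV[R]_#|T|) :
  l2norm (colsubmx M T *m b) <=
  Num.sqrt (\sum_i \sum_j M i j ^+ 2) * l2norm b.
Proof.
have F0 : 0 <= \sum_i \sum_j M i j ^+ 2.
  by rewrite sumr_ge0// => i _; rewrite sumr_ge0// => j _; exact: sqr_ge0.
rewrite -ler_sqr ?nnegrE ?mulr_ge0 ?l2norm_ge0 ?sqrtr_ge0// exprMn (sqr_sqrtr F0).
apply: (le_trans (sqr_l2norm_mulmx _ _)); rewrite ler_wpM2r ?sqr_ge0//.
apply: ler_sum => i _; under eq_bigr do rewrite mxE.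
rewrite -(big_enum_val (fun j => M i j ^+ 2)) big_mkcond; apply: ler_sum => j _.
by case: ifP => // _; exact: sqr_ge0.
Qed.

(** The infimum of an empty set of reals is 0 by convention, so admissible
    constants must be exhibited before the infimum can be compared with them. *)
Lemma ROP_bound_nonempty k k' M : [set c | ROP_bound k k' M c] !=set0.
Proof.
exists (\sum_i \sum_j M i j ^+ 2) => T T' _ _ _ _ b b'.
have F0 : 0 <= \sum_i \sum_j M i j ^+ 2.
  by rewrite sumr_ge0// => i _; rewrite sumr_ge0// => j _; exact: sqr_ge0.
apply: (le_trans (inner_le_l2norm _ _)).
apply: (le_trans (ler_pM _ _ (colsubmx_bound M b) (colsubmx_bound M b'))).
- exact: l2norm_ge0.
- exact: l2norm_ge0.
by rewrite mulrACA -expr2 (sqr_sqrtr F0) mulrA.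
Qed.

(** The infimum defining [ROC] is attained.  Column submatrices are replaced by
    vectors supported on a set, which can be added without changing dimension. *)
Lemma ROC_restr k k' M T T' h h' : (T :&: T')%SET = finset.set0 ->
  (#|T| <= k)%N -> (#|T'| <= k')%N ->
  `|inner (M *m restr T h) (M *m restr T' h')|
    <= ROC k k' M * l2norm (restr T h) * l2norm (restr T' h').
Proof.
move=> TT' Tk Tk'; rewrite -!colsubmx_restr -!l2norm_enum_val -mulrA.
set b := \col_j _; set b' := \col_j _.
have ROPb c : ROP_bound k k' M c ->
    `|inner (colsubmx M T *m b) (colsubmx M T' *m b')|
      <= c * (l2norm b * l2norm b').
  rewrite mulrA; apply => //.
  rewrite -cardsUI TT' cards0 addn0.
  by rewrite -[X in (_ <= X)%N]card_ord max_card.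
have [b0|b0] := eqVneq (l2norm b * l2norm b') 0.
  have [c /ROPb] := ROP_bound_nonempty k k' M.
  by rewrite b0 !mulr0.
have {}b0 : 0 < l2norm b * l2norm b' by rewrite lt0r b0 mulr_ge0 ?l2norm_ge0.
rewrite -ler_pdivrMr//; apply: lb_le_inf; first exact: ROP_bound_nonempty.
by move=> c /ROPb; rewrite ler_pdivrMr.
Qed.

(** Two distinct indices give disjoint singletons, on which any admissible
    constant is compared with 0. *)
Lemma ROC_ge0 k k' M : (0 < k)%N -> (0 < k')%N -> (1 < p)%N -> 0 <= ROC k k' M.
Proof.
move=> k0 k'0 p1; apply: lb_le_inf; first exact: ROP_bound_nonempty.
move=> c ropc.
pose i := Ordinal (ltnW p1); pose j := Ordinal p1.
have ij : ([set i] :&: [set j])%SET = finset.set0.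
  by apply/setP => x; rewrite !inE; apply/negbTE/negP => /andP[/eqP-> /eqP].
have one (x : 'I_p) : l2norm (const_mx 1 : 'cV[R]_#|[set x]%SET|) = 1.
  rewrite /l2norm; under eq_bigr do rewrite mxE expr1n.
  by rewrite sumr_const card_ord cards1 sqrtr1.
have c1 (x : 'I_p) l : (0 < l)%N -> (#|[set x]%SET| <= l)%N by rewrite cards1.
have cp : (#|[set i]%SET| + #|[set j]%SET| <= p)%N by rewrite !cards1.
have := ropc _ _ ij (c1 _ _ k0) (c1 _ _ k'0) cp (const_mx 1) (const_mx 1).
by rewrite !one !mulr1; exact: le_trans.
Qed.

End restricted_constants_theory.

(** * Sums over blocks of decreasing entries *)

Section blocks.
Context {R : realType} (I : finType) (w : I -> R) (w_ge0 : forall i, 0 <= w i).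
Implicit Types (A B D T : {set I}) (M c : R).

Lemma sum_setD A B (f : I -> R) : B \subset A ->
  \sum_(i in A) f i = \sum_(i in B) f i + \sum_(i in (A :\: B)%SET) f i.
Proof.
move=> BA; rewrite (big_setID B)/=; congr (_ + _).
by apply: eq_bigl => i; rewrite (finset.setIidPr BA).
Qed.

(** The k largest entries, selected one at a time; the threshold m separates
    them from the remaining ones.  The bound M is the threshold for k = 0. *)
Lemma top_entries k A M : (k <= #|A|)%N -> 0 <= M ->
  (forall i, i \in A -> w i <= M) ->
  exists B m, [/\ B \subset A, #|B| = k, 0 <= m,
    (forall i, i \in B -> m <= w i) &
    (forall i, i \in (A :\: B)%SET -> w i <= m)].
Proof.
move=> + M0 wM; elim: k => [_|k IH kA].
  exists finset.set0, M; split; rewrite ?finset.sub0set ?cards0//.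
    by move=> i; rewrite inE.
  by move=> i; rewrite inE => /andP[_]; exact: wM.
have [B [m [BA Bk m0 wB wAB]]] := IH (ltnW kA).
have /card_gt0P[i1 i1AB] : (0 < #|(A :\: B)%SET|)%N.
  by rewrite cardsDS// Bk subn_gt0.
pose i0 := [arg max_(i > i1 in (A :\: B)%SET) w i]%O.
have [i0AB i0max] : i0 \in (A :\: B)%SET /\
    forall j, j \in (A :\: B)%SET -> w j <= w i0.
  by rewrite /i0; case: arg_maxP.
exists (i0 |: B)%SET, (w i0); split => //.
- by rewrite finset.subUset finset.sub1set BA andbT; move: i0AB; rewrite inE => /andP[].
- by rewrite cardsU1 Bk; move: i0AB; rewrite inE => /andP[->].
- move=> i; rewrite !inE => /orP[/eqP->//|iB].
  exact: le_trans (wAB _ i0AB) (wB _ iB).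
- move=> i; rewrite !inE negb_or -andbA => /and3P[_ iB iA].
  by apply: i0max; rewrite inE iB.
Qed.

Variables (S : nat) (S_gt0 : (0 < S)%N).

Let sqrtS_gt0 : 0 < Num.sqrt S%:R :> R.
Proof. by rewrite sqrtr_gt0 ltr0n. Qed.

Let sqrtS_sqr : Num.sqrt S%:R * Num.sqrt S%:R = S%:R :> R.
Proof. by rewrite -expr2 sqr_sqrtr. Qed.

Lemma threshold_le_sum B m : #|B| = S -> (forall i, i \in B -> m <= w i) ->
  Num.sqrt S%:R * m <= (\sum_(i in B) w i) / Num.sqrt S%:R.
Proof.
move=> BS wB; rewrite ler_pdivlMr// mulrAC sqrtS_sqr mulr_natl -BS -sumr_const.
exact: ler_sum.
Qed.

Section subadditive.
Variables (F : {set I} -> R) (c : R) (c_ge0 : 0 <= c) (D : {set I}).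
Hypothesis F_subadd : forall A B, (A :&: B)%SET = finset.set0 ->
  F (A :|: B)%SET <= F A + F B.
Hypothesis F_small : forall B, B \subset D -> (#|B| <= S)%N ->
  F B <= c * Num.sqrt (\sum_(i in B) w i ^+ 2).

(** Cut A into blocks of S entries in decreasing order.  The l2 norm of a block
    is at most sqrt S times its largest entry, which is at most the average of
    the previous block, so the l2 norms of the blocks add up to at most the l1
    norm divided by sqrt S; M plays the role of the average of a block
    preceding A.  The function F abstracts the two quantities to be summed over
    the blocks: an l2 norm and an inner product. *)
Lemma block_sum A M : A \subset D -> 0 <= M ->
  (forall i, i \in A -> w i <= M) ->
  F A <= c * (Num.sqrt S%:R * M + (\sum_(i in A) w i) / Num.sqrt S%:R).
Proof.
have [k] := ubnP #|A|; elim: k A M => // k IH A M Ak AD M0 wM.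
have sqrtM B : (#|B| <= S)%N -> B \subset A ->
    Num.sqrt (\sum_(i in B) w i ^+ 2) <= Num.sqrt S%:R * M.
  move=> BS BA; rewrite -[X in _ * X]ger0_norm// -sqrtr_sqr -sqrtrM ?ler0n//.
  rewrite ler_wsqrtr//; apply: (@le_trans _ _ (\sum_(i in B) M ^+ 2)).
    apply: ler_sum => i iB; rewrite ler_sqr ?nnegrE//.
    by apply: wM; exact: (fintype.subsetP BA).
  by rewrite sumr_const -[leLHS]mulr_natl ler_wpM2r ?sqr_ge0// ler_nat.
have [AS|SA] := leqP #|A| S.
  apply: (le_trans (F_small AD AS)); rewrite ler_wpM2l//.
  apply: (le_trans (sqrtM _ AS _)) => //.
  by rewrite lerDl divr_ge0 ?sumr_ge0// ltW.
have [B [m [BA BS m0 mB mAB]]] := top_entries (ltnW SA) M0 wM.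
have -> : F A = F (B :|: (A :\: B))%SET.
  congr F; apply/setP => i; rewrite !inE; have := fintype.subsetP BA i.
  by do 2 case: (i \in _) => //=; move=> /(_ isT).
have BAB : (B :&: (A :\: B))%SET = finset.set0.
  by apply/setP => i; rewrite !inE; case: (i \in B).
apply: (le_trans (F_subadd BAB)).
rewrite (sum_setD w BA) mulrDl.
have h1 : F B <= c * (Num.sqrt S%:R * M).
  apply: (le_trans (F_small (fintype.subset_trans BA AD) _)); first by rewrite BS.
  by rewrite ler_wpM2l// sqrtM// BS.
have h2 : F (A :\: B)%SET <= c * (Num.sqrt S%:R * m +
    (\sum_(i in (A :\: B)%SET) w i) / Num.sqrt S%:R).
  apply: IH => //.
  - rewrite cardsDS// BS; lia.
  - exact: fintype.subset_trans (finset.subsetDl _ _) AD.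
have := threshold_le_sum BS mB => /(ler_wpM2l c_ge0) h3.
lra.
Qed.

End subadditive.

(** Removing the first block T removes the contribution of M: the block that
    precedes the rest is now T itself. *)
Lemma first_block A : exists T, [/\ T \subset A, (#|T| <= S)%N &
  forall (F : {set I} -> R) c, 0 <= c ->
    (forall B C, (B :&: C)%SET = finset.set0 -> F (B :|: C)%SET <= F B + F C) ->
    (forall B, B \subset (A :\: T)%SET -> (#|B| <= S)%N ->
      F B <= c * Num.sqrt (\sum_(i in B) w i ^+ 2)) ->
    F (A :\: T)%SET <= c * ((\sum_(i in A) w i) / Num.sqrt S%:R)].
Proof.
have [AS|SA] := leqP #|A| S.
  exists A; split => // F c c0 _ Fs; apply: (le_trans (Fs _ _ _)) => //.
    by rewrite finset.setDv cards0.
  by rewrite finset.setDv big_set0 sqrtr0 mulr0 mulr_ge0// divr_ge0 ?sumr_ge0//.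
have wM i : i \in A -> w i <= \sum_j w j.
  by move=> _; rewrite (bigD1 i)//= lerDl sumr_ge0.
have [B [m [BA BS m0 mB mAB]]] :=
  top_entries (ltnW SA) (sumr_ge0 _ (fun i _ => w_ge0 i)) wM.
exists B; split => //; first by rewrite BS.
move=> F c c0 Fsub Fs.
apply: (le_trans (block_sum c0 Fsub Fs (subxx _) m0 mAB)).
by rewrite ler_wpM2l// (sum_setD w BA) mulrDl lerD2r threshold_le_sum.
Qed.

End blocks.

(** * Sparse vectors and stability on the cone *)

Section sparse.
Context {R : realType} (p : nat).
Implicit Types (b : 'cV[R]_p) (T : {set 'I_p}).

(** The best S-term approximation keeps S entries unchanged and drops the
    others, so the infimum is a minimum over finitely many supports. *)
Lemma approx_sparseP S (r : R) b : approx_sparse S r b <->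
  exists T, (#|T| <= S)%N /\ \sum_(i in (~: T)%SET) `|b i 0| <= r.
Proof.
split.
  move=> br.
  have S0 : (#|(finset.set0 : {set 'I_p})| <= S)%N by rewrite cards0.
  pose tail (T : {set 'I_p}) := \sum_(i in (~: T)%SET) `|b i 0|.
  pose T0 := [arg min_(T < (finset.set0 : {set 'I_p}) | (#|T| <= S)%N) tail T]%O.
  have [T0S T0min] : (#|T0| <= S)%N /\
      forall T, (#|T| <= S)%N -> tail T0 <= tail T.
    by rewrite /T0; case: arg_minP.
  exists T0; split => //; apply: le_trans br; apply: lb_le_inf.
    exists (l1norm (b - 0)); exists 0 => //=.
    by rewrite /l0norm eq_card0// => i; rewrite !inE mxE eqxx.
  move=> _ [c cS <-]; apply: (le_trans (T0min [set i | c i 0 != 0]%SET _)).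
    by rewrite cardsE.
  rewrite /tail /l1norm big_mkcond; apply: ler_sum => i _; rewrite !inE negbK.
  by case: eqP => // c0; rewrite !mxE c0 subr0.
move=> [T [TS tailr]]; apply: le_trans tailr.
apply: (@le_trans _ _ (l1norm (b - restr T b))).
  apply: ge_inf.
    by exists 0 => _ [c _ <-]; apply: sumr_ge0.
  by exists (restr T b) => //=; exact: leq_trans (l0norm_restr _ _) TS.
rewrite /l1norm [leRHS]big_mkcond; apply: ler_sum => i _; rewrite !mxE inE.
by case: ifP => _ /=; rewrite ?subrr ?normr0 ?subr0.
Qed.

(** On T the l1 norm decreases by at most the mass of h there, off T it
    increases by at least the mass of h minus twice the mass of b; the balance
    cannot be positive. *)
Lemma l1norm_cone b h T (r : R) :
  l1norm (b + h) <= l1norm b -> \sum_(i in (~: T)%SET) `|b i 0| <= r ->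
  \sum_(i in (~: T)%SET) `|h i 0| <= \sum_(i in T) `|h i 0| + 2 * r.
Proof.
move=> bh br.
have l1E (c : 'cV[R]_p) : l1norm c = \sum_(i in T) `|c i 0| + \sum_(i in (~: T)%SET) `|c i 0|.
  rewrite /l1norm (bigID (mem T))/=; congr (_ + _).
  by apply: eq_bigl => i; rewrite inE.
have hT : \sum_(i in T) `|b i 0| - \sum_(i in T) `|h i 0| <=
    \sum_(i in T) `|(b + h) i 0|.
  rewrite -sumrB; apply: ler_sum => i _; rewrite mxE -[h i 0]opprK normrN.
  exact: lerB_dist.
have hTc : \sum_(i in (~: T)%SET) `|h i 0| - \sum_(i in (~: T)%SET) `|b i 0| <=
    \sum_(i in (~: T)%SET) `|(b + h) i 0|.
  rewrite -sumrB; apply: ler_sum => i _; rewrite mxE addrC -[b i 0]opprK normrN.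
  exact: lerB_dist.
by move: bh; rewrite !l1E; lra.
Qed.

End sparse.

Section stability.
Context {R : realType} (n p S : nat) (M : 'M[R]_(n, p)).
Hypotheses (S_gt0 : (0 < S)%N) (p_gt1 : (1 < p)%N).
Let delta := RIC (2 * S) M.
Let theta := ROC S (2 * S) M.
Hypothesis RIP : delta + theta < 1.

Lemma sum_abs_restr (A : {set 'I_p}) k (h : 'cV[R]_p) : (#|A| <= k)%N ->
  \sum_(i in A) `|h i 0| <= Num.sqrt k%:R * l2norm (restr A h).
Proof.
move=> Ak.
have s0 : 0 <= \sum_(i in A) `|h i 0| by exact: sumr_ge0.
rewrite -ler_sqr ?nnegrE ?mulr_ge0 ?l2norm_ge0 ?sqrtr_ge0//.
rewrite exprMn sqr_l2norm_restr (sqr_sqrtr (ler0n _ k)).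
have := sum_cauchy_schwarz A (fun=> 1) (fun i => `|h i 0|).
under eq_bigr do rewrite mul1r.
move=> /le_trans; apply; apply: ler_pM.
- by apply: sumr_ge0 => i _; exact: sqr_ge0.
- by apply: sumr_ge0 => i _; exact: sqr_ge0.
- by under eq_bigr do rewrite expr1n; rewrite sumr_const ler_nat.
- by under eq_bigr do rewrite real_normK ?num_real//.
Qed.

Lemma l2norm_restrE (A : {set 'I_p}) (h : 'cV[R]_p) :
  l2norm (restr A h) = Num.sqrt (\sum_(i in A) `|h i 0| ^+ 2).
Proof.
rewrite -[LHS]ger0_norm ?l2norm_ge0// -sqrtr_sqr sqr_l2norm_restr.
by congr Num.sqrt; apply: eq_bigr => i _; rewrite real_normK ?num_real.
Qed.

(** With T01 the union of T and of the first block of its complement, the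
    restricted isometry bounds the squared norm u^2 of h on T01 by
    |M h_T01|^2 = <h_T01, M^T M h> - <M h_T01, M h_rest>.  The first term is
    small by the correlation bound, the second is at most theta times u times
    the l1 mass off T over sqrt S, which the cone condition brings back to u.
    As delta + theta < 1, u can be absorbed; the rest of h is no larger than
    that l1 mass over sqrt S. *)
Theorem cone_stability (h : 'cV[R]_p) (T : {set 'I_p}) (r L : R) :
  (#|T| <= S)%N -> 0 <= r ->
  \sum_(i in (~: T)%SET) `|h i 0| <= \sum_(i in T) `|h i 0| + 2 * r ->
  (forall j, `|(M^T *m (M *m h)) j 0| <= L) ->
  l2norm h <= 2 * Num.sqrt (2 * S)%:R * L / (1 - delta - theta)
    + 2 * ((1 - delta + theta) / (1 - delta - theta)) * (r / Num.sqrt S%:R).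
Proof.
move=> TS r0 cone corr.
have theta0 : 0 <= theta by apply: ROC_ge0 => //; rewrite muln_gt0.
have L0 : 0 <= L by apply: le_trans (corr (Ordinal p_gt1)).
have sS : 0 < Num.sqrt S%:R :> R by rewrite sqrtr_gt0 ltr0n.
have [T1 [T1T T1S block]] :=
  first_block (w := fun i => `|h i 0|) (fun i => normr_ge0 _) S_gt0 (~: T)%SET.
set N := (\sum_(i in _) _) / Num.sqrt S%:R in block.
pose T01 := (T :|: T1)%SET.
have restE : (~: T :\: T1)%SET = (~: T01)%SET.
  by apply/setP => i; rewrite !inE negb_or andbC.
rewrite restE in block.
have T01S : (#|T01| <= 2 * S)%N.
  by apply: leq_trans (leq_card_setU _ _) _; rewrite mul2n -addnn leq_add.
pose u := l2norm (restr T01 h).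
have u0 : 0 <= u by exact: l2norm_ge0.
have restrU_le A B : (A :&: B)%SET = finset.set0 ->
    l2norm (restr (A :|: B)%SET h) <= l2norm (restr A h) + l2norm (restr B h).
  by move=> AB; rewrite restrU//; exact: ler_l2normD.
have rest_le : l2norm (restr (~: T01)%SET h) <= N.
  rewrite -[N]mul1r; apply: (block (fun A => l2norm (restr A h))) => //.
  by move=> B _ _; rewrite mul1r l2norm_restrE.
have cross_le : `|inner (M *m restr (~: T01)%SET h) (M *m restr T01 h)|
    <= theta * u * N.
  apply: (block (fun A => `|inner (M *m restr A h) (M *m restr T01 h)|)).
  - exact: mulr_ge0.
  - move=> A B AB; rewrite restrU// mulmxDr innerC innerDr innerC.
    rewrite (innerC (M *m restr T01 h)); exact: ler_normD.
  - move=> B BT01 BS; rewrite -l2norm_restrE mulrAC; apply: ROC_restr => //.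
    apply/setP => i; rewrite !inE; apply/negbTE/negP => /andP[iB].
    by have := fintype.subsetP BT01 i iB; rewrite !inE => /norP[/negbTE-> /negbTE->].
have N_le : N <= u + 2 * r / Num.sqrt S%:R.
  rewrite /N ler_pdivrMr// mulrDl divfK ?gt_eqF//; apply: (le_trans cone).
  rewrite lerD2r; apply: (le_trans (sum_abs_restr h TS)).
  rewrite mulrC ler_wpM2r// ?(ltW sS)// -ler_sqr ?nnegrE ?l2norm_ge0//.
  rewrite !sqr_l2norm_restr [leLHS]big_mkcond [leRHS]big_mkcond.
  apply: ler_sum => i _; rewrite inE; case: (i \in T) => //=.
  by case: ifP => // _; exact: sqr_ge0.
have energy : (1 - delta) * u ^+ 2 <=
    Num.sqrt (2 * S)%:R * u * L + theta * u * N.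
  apply: (@le_trans _ _ (l2norm (M *m restr T01 h) ^+ 2)).
    by apply: RIC_lower; exact: leq_trans (l0norm_restr _ _) T01S.
  have -> : l2norm (M *m restr T01 h) ^+ 2 =
      inner (restr T01 h) (M^T *m (M *m h)) -
      inner (M *m restr (~: T01)%SET h) (M *m restr T01 h).
    rewrite -inner_trmx [in M *m h](restr_setC T01 h) mulmxDr innerDr.
    by rewrite [X in _ + X - _]innerC addrK sqr_l2normE.
  rewrite lerD//; last first.
    by apply: le_trans cross_le; rewrite -normrN; exact: ler_norm.
  rewrite inner_restr; apply: (@le_trans _ _ (\sum_(i in T01) `|h i 0| * L)).
    apply: ler_sum => i _; apply: (le_trans (ler_norm _)).
    by rewrite normrM ler_wpM2l.
  by rewrite -mulr_suml ler_wpM2r// sum_abs_restr.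
have gap : 0 < 1 - delta - theta by move: RIP; lra.
have u_le : (1 - delta - theta) * u <=
    Num.sqrt (2 * S)%:R * L + 2 * theta * (r / Num.sqrt S%:R).
  have rS : 0 <= r / Num.sqrt S%:R by rewrite divr_ge0// ltW.
  have [u00|un0] := eqVneq u 0.
    by rewrite u00 mulr0 addr_ge0 ?mulr_ge0 ?sqrtr_ge0.
  have {}un0 : 0 < u by rewrite lt0r un0.
  rewrite -(ler_pM2r un0).
  have : theta * u * N <= theta * u * (u + 2 * r / Num.sqrt S%:R).
    by rewrite ler_wpM2l// mulr_ge0.
  move: energy; rewrite expr2; lra.
have h_le : l2norm h <= 2 * u + 2 * (r / Num.sqrt S%:R).
  rewrite {1}(restr_setC T01 h); apply: (le_trans (ler_l2normD _ _)).
  by move: rest_le N_le; rewrite -/u; lra.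
apply: (le_trans h_le).
have -> : 2 * Num.sqrt (2 * S)%:R * L / (1 - delta - theta)
    + 2 * ((1 - delta + theta) / (1 - delta - theta)) * (r / Num.sqrt S%:R) =
    (2 * (Num.sqrt (2 * S)%:R * L + 2 * theta * (r / Num.sqrt S%:R))
     / (1 - delta - theta)) + 2 * (r / Num.sqrt S%:R).
  by field; rewrite !gt_eqF.
rewrite lerD2r ler_pdivlMr//; move: u_le; lra.
Qed.

End stability.

Section deterministic.
Context {R : realType} (n p S : nat) (X : 'M[R]_(n, p)).
Hypotheses (n_gt0 : (0 < n)%N) (S_gt0 : (0 < S)%N) (p_gt1 : (1 < p)%N).
Hypothesis X_cols : forall j, \sum_i X i j ^+ 2 = n%:R.

(** The cone condition and its hypotheses are symmetric in b and b0 up to the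
    comparison of their l1 norms, so it may be applied starting from the vector
    with the larger one. *)
Lemma sparse_diff_cone (r : R) (b b0 : 'cV[R]_p) :
  approx_sparse S r b -> approx_sparse S r b0 ->
  exists T : {set 'I_p}, (#|T| <= S)%N /\
    \sum_(i in (~: T)%SET) `|(b - b0) i 0|
      <= \sum_(i in T) `|(b - b0) i 0| + 2 * r.
Proof.
wlog le_b : b b0 / l1norm b <= l1norm b0 => [hwlog|].
  move=> bP b0P; have [/hwlog|/ltW /hwlog] := leP (l1norm b) (l1norm b0); first exact.
  move=> /(_ b0P bP) [T [TS cone]]; exists T; split => //.
  have sym i : `|(b - b0) i 0| = `|(b0 - b) i 0| by rewrite !mxE distrC.
  by under eq_bigr do rewrite sym; under [X in _ <= X + _]eq_bigr do rewrite sym.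
move=> _ /approx_sparseP[T [TS tail]]; exists T; split => //.
by apply: l1norm_cone tail; rewrite addrC subrK.
Qed.

(** |X h|^2 = <h, X^T X h>, and every entry of X^T v is at most sqrt n |v|. *)
Lemma l2norm_mulmx_le_l1norm (h : 'cV[R]_p) :
  l2norm (X *m h) ^+ 2 <= n%:R * l1norm h ^+ 2.
Proof.
have h1 : 0 <= l1norm h by exact: sumr_ge0.
have colX j (v : 'cV[R]_n) : `|(X^T *m v) j 0| <= Num.sqrt n%:R * l2norm v.
  have -> : (X^T *m v) j 0 = inner (col j X) v.
    by rewrite mxE; apply: eq_bigr => i _; rewrite !mxE.
  apply: (le_trans (inner_le_l2norm _ _)); rewrite ler_wpM2r ?l2norm_ge0//.
  by rewrite /l2norm; under eq_bigr do rewrite mxE; rewrite X_cols.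
have sq : l2norm (X *m h) ^+ 2 <= Num.sqrt n%:R * l1norm h * l2norm (X *m h).
  rewrite sqr_l2normE inner_trmx; apply: (le_trans (ler_norm _)).
  rewrite mulrAC mulrC /l1norm mulr_suml; apply: (le_trans (ler_norm_sum _ _ _)).
  by apply: ler_sum => j _; rewrite normrM ler_wpM2l.
have [v0|v0] := eqVneq (l2norm (X *m h)) 0.
  by rewrite v0 expr0n mulr_ge0// sqr_ge0.
have {}v0 : 0 < l2norm (X *m h) by rewrite lt0r v0 l2norm_ge0.
move: sq; rewrite expr2 ler_pM2r// => sq.
rewrite -[n%:R in leRHS]sqr_sqrtr// -exprMn -expr2.
by rewrite ler_sqr ?nnegrE ?mulr_ge0 ?l2norm_ge0 ?sqrtr_ge0.
Qed.

(** The stability bound for the normalised matrix.  The constant 8/3, twice the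
    4/3 of the correlation bounds, gives 32/3 in place of the 16 allowed by
    2 * eps, hence the strict inequality. *)
Theorem sparse_diff_close (r sigma alpha : R) (b b0 : 'cV[R]_p) :
  let Xt := (Num.sqrt n%:R)^-1 *: X in
  let delta := RIC (2 * S) Xt in
  let theta := ROC S (2 * S) Xt in
  let eps := 8 * sigma / (1 - delta - theta)
               * Num.sqrt ((1 + alpha) * S%:R * ln p%:R / n%:R)
             + 2 * ((1 - delta + theta) / (1 - delta - theta))
               * (r / Num.sqrt S%:R) in
  0 <= r -> 0 < sigma -> 0 < alpha -> delta + theta < 1 ->
  approx_sparse S r b -> approx_sparse S r b0 ->
  (forall j, `|(X^T *m (X *m (b - b0))) j 0| <=
     8 / 3 * (sigma * Num.sqrt (2 * n%:R * (1 + alpha) * ln p%:R))) ->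
  l2norm (b - b0) < 2 * eps.
Proof.
move=> Xt delta theta eps r0 s0 a0 RIP bP b0P corr.
have [T [TS cone]] := sparse_diff_cone bP b0P.
have L0 : 0 < ln p%:R :> R by rewrite ln_gt0// ltr1n.
have n0 : 0 < n%:R :> R by rewrite ltr0n.
have SR0 : 0 < S%:R :> R by rewrite ltr0n.
have sS : 0 < Num.sqrt S%:R :> R by rewrite sqrtr_gt0.
have gap : 0 < 1 - delta - theta by move: RIP; lra.
have theta0 : 0 <= theta by apply: ROC_ge0 => //; rewrite muln_gt0.
pose L := 8 / 3 * (sigma * Num.sqrt (2 * n%:R * (1 + alpha) * ln p%:R)) / n%:R.
have corrt j : `|(Xt^T *m (Xt *m (b - b0))) j 0| <= L.
  rewrite /Xt linearZ/= -!scalemxAl -scalemxAr scalerA.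
  rewrite -invfM -expr2 (sqr_sqrtr (ltW n0)).
  by rewrite mxE normrM ger0_norm ?invr_ge0 ?(ltW n0)// mulrC ler_wpM2r ?invr_ge0 ?(ltW n0)//.
have := cone_stability S_gt0 p_gt1 RIP TS r0 cone corrt.
rewrite -/delta -/theta => /le_lt_trans; apply.
set Q := Num.sqrt _ in eps *.
have arg0 : 0 < (1 + alpha) * S%:R * ln p%:R / n%:R.
  by rewrite divr_gt0 ?mulr_gt0// ltr_wpDl// ltW.
have Q0 : 0 < Q by rewrite sqrtr_gt0.
have scale : Num.sqrt (2 * S)%:R * Num.sqrt (2 * n%:R * (1 + alpha) * ln p%:R) =
    2 * n%:R * Q.
  rewrite -sqrtrM ?ler0n//.
  have -> : (2 * S)%:R * (2 * n%:R * (1 + alpha) * ln p%:R) =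
      (2 * n%:R) ^+ 2 * ((1 + alpha) * S%:R * ln p%:R / n%:R).
    by rewrite natrM; field; rewrite gt_eqF.
  by rewrite sqrtrM ?sqr_ge0// sqrtr_sqr ger0_norm// mulr_ge0// ltW.
set rho := (1 - delta + theta) / (1 - delta - theta) in eps *.
have rho0 : 0 <= rho * (r / Num.sqrt S%:R).
  rewrite mulr_ge0 ?divr_ge0//; [|exact: ltW..].
  by move: gap theta0; lra.
have -> : 2 * Num.sqrt (2 * S)%:R * L / (1 - delta - theta) =
    32 / 3 * (sigma / (1 - delta - theta) * Q).
  have -> : 2 * Num.sqrt (2 * S)%:R * L / (1 - delta - theta) =
      16 / 3 * sigma / n%:R / (1 - delta - theta) *
      (Num.sqrt (2 * S)%:R * Num.sqrt (2 * n%:R * (1 + alpha) * ln p%:R)).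
    by rewrite /L; field; rewrite !gt_eqF.
  by rewrite scale; field; rewrite !gt_eqF.
have main0 : 0 < sigma / (1 - delta - theta) * Q by rewrite mulr_gt0 ?divr_gt0.
rewrite /eps; move: main0 rho0; rewrite -!mulrA; lra.
Qed.

End deterministic.

(** * Translation of Gaussian noise *)

Section gaussian_shift_1d.
Context {R : realType}.
Implicit Types (m s : R).

(** The normal law is defined by its values on sets; the density is identified
    with the Radon-Nikodym derivative, for which the formula is known. *)
Lemma integral_normal_prob m s (f : R -> \bar R) :
  measurable_fun setT f -> (forall x, 0 <= f x)%E ->
  (\int[normal_prob m s]_x f x =
   \int[lebesgue_measure]_x (f x * (normal_pdf m s x)%:E))%E.
Proof.
move=> mf f0.
pose nu : probability (measurableTypeR R) R := normal_prob m s.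
pose mu : {sigma_finite_measure set (measurableTypeR R) -> \bar R} :=
  lebesgue_measure.
have numu : nu `<< mu by exact: normal_prob_dominates.
have mpdf : measurable_fun [set: R] (EFin \o normal_pdf m s).
  by apply/measurable_EFinP; exact: measurable_normal_pdf.
rewrite -[LHS](Radon_Nikodym_SigmaFinite.change_of_variables
  (nu := nu) (mu := mu) numu)//.
have mg := measurable_int _ (Radon_Nikodym_SigmaFinite.f_integrable numu).
apply: ae_eq_integral => //.
- exact: emeasurable_funM.
- exact: emeasurable_funM.
apply: ae_eqe_mul2l; apply: integral_ae_eq => //.
- exact: Radon_Nikodym_SigmaFinite.f_integrable.
- by move=> E _ mE; rewrite -Radon_Nikodym_SigmaFinite.f_integral.
Qed.

Definition translate m : measurableTypeR R -> measurableTypeR R :=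
  fun x => x + m.

Lemma measurable_translate m : measurable_fun setT (translate m).
Proof. exact: measurable_funD. Qed.

HB.instance Definition _ m :=
  isMeasurableFun.Build _ _ _ _ (translate m) (measurable_translate m).

Lemma lebesgue_measure_translate m (A : set R) : measurable A ->
  pushforward lebesgue_measure (translate m) A = lebesgue_measure A.
Proof.
move=> mA; apply/esym/lebesgue_measure_unique => //= _ [[a b] _ <-].
rewrite /pushforward /=.
rewrite (_ : _ @^-1` _ = `]a - m, b - m]%classic); last first.
  by apply/seteqP; split => x /=; rewrite !in_itv/= ltrBlDr lerBrDr.
rewrite !lebesgue_measure_itv/= !lte_fin ltrD2r -!EFinD.
by case: ifPn => // _; congr (_%:E); ring.
Qed.

Lemma ge0_integral_translate m (f : R -> \bar R) :
  measurable_fun setT f -> (forall x, 0 <= f x)%E ->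
  (\int[lebesgue_measure]_x f (x + m)%R = \int[lebesgue_measure]_x f x)%E.
Proof.
move=> mf f0.
rewrite -[RHS](@eq_measure_integral _ _ _ _ _
  (pushforward lebesgue_measure (translate m))); last first.
  by move=> A mA _; exact: lebesgue_measure_translate.
by rewrite ge0_integral_pushforward//; exact: measurable_translate.
Qed.

(** Completing the square in the normal density. *)
Lemma normal_prob_translate s m (f : R -> \bar R) : s != 0 ->
  measurable_fun setT f -> (forall x, 0 <= f x)%E ->
  (\int[normal_prob 0 s]_x f (x + m)%R =
   \int[normal_prob 0 s]_x
     (f x * (expR (x * m / s ^+ 2 - m ^+ 2 / (2 * s ^+ 2)))%:E))%E.
Proof.
move=> s0 mf f0.
have mw : measurable_fun [set: R] (fun x : R =>
    (expR (x * m / s ^+ 2 - m ^+ 2 / (2 * s ^+ 2)))%:E).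
  apply/measurable_EFinP; apply: measurableT_comp => //.
  by apply: measurable_funB => //; apply: measurable_funM => //; exact: measurable_funM.
have mfm : measurable_fun [set: R] (fun x : R => f (x + m)).
  exact: (measurableT_comp mf (measurable_translate m)).
have mpdf c : measurable_fun [set: R] (fun x : R => (normal_pdf c s x)%:E).
  by apply/measurable_EFinP; exact: measurable_normal_pdf.
rewrite [LHS]integral_normal_prob//.
rewrite integral_normal_prob//; last 2 first.
- exact: emeasurable_funM.
- by move=> x; rewrite mule_ge0// lee_fin expR_ge0.
rewrite -[RHS](ge0_integral_translate m); last 2 first.
- by apply: emeasurable_funM => //; exact: emeasurable_funM.
- by move=> x; rewrite !mule_ge0// lee_fin ?expR_ge0 ?normal_pdf_ge0.
apply: eq_integral => x _; rewrite -muleA; congr (_ * _)%E.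
rewrite -EFinM !normal_pdfE// mulrCA -expRD; congr (_ * expR _)%:E.
by rewrite !subr0; field.
Qed.

End gaussian_shift_1d.

Section gaussian_shift.
Context {R : realType}.
Implicit Types (n : nat) (s : R).

Definition translate_tuple n (m : 'I_n -> R) (e : n.-tuple (measurableTypeR R)) :
    n.-tuple (measurableTypeR R) :=
  [tuple (tnth e i + m i : measurableTypeR R) | i < n].

Definition noise n s : probability (n.-tuple (measurableTypeR R)) R :=
  prob_power (normal_prob 0 s) n.

Lemma measurable_coord n (i : 'I_n) :
  measurable_fun setT (fun e : n.-tuple (measurableTypeR R) => tnth e i : R).
Proof. exact: measurable_tnth. Qed.

Lemma measurable_linear_form n (a : 'I_n -> R) :
  measurable_fun setT
    (fun e : n.-tuple (measurableTypeR R) => \sum_i (tnth e i : R) * a i).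
Proof.
by apply: measurable_sum => i; apply: measurable_funM => //; exact: measurable_coord.
Qed.

Lemma measurable_translate_tuple n (m : 'I_n -> R) :
  measurable_fun setT (translate_tuple m).
Proof.
apply/measurable_fun_tnthP => i.
rewrite (_ : _ \o _ = fun e => (tnth e i : R) + m i); last first.
  by apply/funext => e /=; rewrite tnth_mktuple.
by apply: measurable_funD => //; exact: measurable_coord.
Qed.

(** The density of N(m, s^2 I_n) with respect to N(0, s^2 I_n). *)
Definition shift_density n s (m : 'I_n -> R) (e : n.-tuple (measurableTypeR R)) : R :=
  expR ((\sum_i (tnth e i : R) * m i) / s ^+ 2
        - (\sum_i m i ^+ 2) / (2 * s ^+ 2)).

Lemma measurable_shift_density n s (m : 'I_n -> R) :
  measurable_fun setT (shift_density s m).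
Proof.
apply: measurableT_comp => //; apply: measurable_funB => //.
by apply: measurable_funM => //; exact: measurable_linear_form.
Qed.

Lemma integral_noise_rec n s (f : n.+1.-tuple (measurableTypeR R) -> \bar R) :
  measurable_fun setT f -> (forall e, 0 <= f e)%E ->
  (\int[noise n.+1 s]_e f e =
   \int[normal_prob 0 s]_x \int[noise n s]_e f (cons_pair (x, e)))%E.
Proof.
move=> mf f0; rewrite /noise /= ge0_integral_distribution//.
rewrite fubini_tonelli1//; last by move=> x; exact: f0.
by apply: measurableT_comp => //; exact: measurable_cons_pair.
Qed.

(** The Cameron-Martin formula in finite dimension: e + m has density
    [shift_density] with respect to e.  Coordinates are treated one at a time. *)
Theorem noise_translate n s (m : 'I_n -> R)
    (f : n.-tuple (measurableTypeR R) -> \bar R) : s != 0 ->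
  measurable_fun setT f -> (forall e, 0 <= f e)%E ->
  (\int[noise n s]_e f (translate_tuple m e) =
   \int[noise n s]_e (f e * (shift_density s m e)%:E))%E.
Proof.
move=> s0; elim: n m f => [|n IH] m f mf f0.
  apply: eq_integral => e _.
  rewrite /shift_density !big_ord0 !mul0r subr0 expR0 mule1.
  by rewrite (tuple0 (translate_tuple m e)) (tuple0 e).
have mfd : measurable_fun setT (fun e => f e * (shift_density s m e)%:E)%E.
  apply: emeasurable_funM => //.
  by apply/measurable_EFinP; exact: measurable_shift_density.
have fd0 e : (0 <= f e * (shift_density s m e)%:E)%E.
  by rewrite mule_ge0// lee_fin expR_ge0.
rewrite !integral_noise_rec//; last first.
  exact: (measurableT_comp mf (measurable_translate_tuple m)).
pose m' i := m (lift ord0 i).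
have mcons x : measurable_fun setT
    (fun e : n.-tuple (measurableTypeR R) => f (cons_pair (x : measurableTypeR R, e))).
  apply: measurableT_comp => //.
  by apply: (measurableT_comp (measurable_cons_pair (n := n))); exact: measurable_fun_pair.
pose H (x : R) := (\int[noise n s]_e
  (f (cons_pair (x : measurableTypeR R, e)) * (shift_density s m' e)%:E))%E.
transitivity (\int[normal_prob 0 s]_x H ((x : R) + m ord0)%R)%E.
  apply: eq_integral => x _; rewrite /H -IH//.
  apply: eq_integral => e _; congr f.
  apply: eq_from_tnth => i; rewrite tnth_mktuple.
  have [j ->|->] := unliftP ord0 i; last by rewrite !tnth0.
  by rewrite !tnthS tnth_mktuple.
have mdens : measurable_fun setT (fun e => (shift_density s m' e)%:E).
  by apply/measurable_EFinP; exact: measurable_shift_density.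
rewrite normal_prob_translate//.
- apply: eq_integral => x _; rewrite /H muleC -ge0_integralZl//.
  + apply: eq_integral => e _; rewrite muleCA -EFinM -expRD.
    rewrite /shift_density !big_ord_recl !tnth0.
    under [in RHS]eq_bigr do rewrite tnthS.
    congr (_ * (expR _)%:E)%E; rewrite /m'.
    by rewrite /=; field.
  + by apply: emeasurable_funM; [exact: mcons|exact: mdens].
  + by move=> e _; rewrite mule_ge0// lee_fin expR_ge0.
- apply: (measurable_fun_fubini_tonelli_F (m2 := noise n s)
    (fun xe : measurableTypeR R * n.-tuple (measurableTypeR R) =>
      f (cons_pair xe) * (shift_density s m' xe.2)%:E)%E).
  + apply: emeasurable_funM; first exact: (measurableT_comp mf (measurable_cons_pair (n := n))).
    exact: (measurableT_comp mdens measurable_snd).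
  + by move=> xe; rewrite mule_ge0// lee_fin expR_ge0.
- by move=> x; apply: integral_ge0 => e _; rewrite mule_ge0// lee_fin expR_ge0.
Qed.

End gaussian_shift.

(** * Gaussian tails *)

Section gaussian_tail.
Context {R : realType}.
Implicit Types (n : nat) (s : R).

Lemma measurable_half_space n (a : 'I_n -> R) (l : R) :
  measurable [set e : n.-tuple (measurableTypeR R) |
    l < \sum_i (tnth e i : R) * a i].
Proof.
rewrite (_ : [set e | _] =
    (fun e : n.-tuple (measurableTypeR R) => \sum_i (tnth e i : R) * a i)
      @^-1` `]l, +oo[%classic); last first.
  by apply/seteqP; split => e /=; rewrite in_itv/= andbT.
by rewrite -[X in measurable X]setTI; apply: measurable_linear_form.
Qed.

Lemma measurable_slab n (a : 'I_n -> R) (l : R) :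
  measurable [set e : n.-tuple (measurableTypeR R) |
    l < `|\sum_i (tnth e i : R) * a i|].
Proof.
rewrite (_ : [set e | _] =
    (fun e : n.-tuple (measurableTypeR R) => `|\sum_i (tnth e i : R) * a i|)
      @^-1` `]l, +oo[%classic); last first.
  by apply/seteqP; split => e /=; rewrite in_itv/= andbT.
rewrite -[X in measurable X]setTI.
have mabs : measurable_fun setT
    (fun e : n.-tuple (measurableTypeR R) => `|\sum_i (tnth e i : R) * a i|).
  by apply: measurableT_comp => //; exact: measurable_linear_form.
by apply: mabs.
Qed.

(** Translate the noise by - (l / |a|^2) a, which maps the half-space of level l
    onto the half-space of level 0.  On the latter the density of the translate
    is at most exp (- l^2 / (2 s^2 |a|^2)), its linear term being negative. *)
Lemma noise_half_space n s (a : 'I_n -> R) (l : R) :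
  s != 0 -> 0 < \sum_i a i ^+ 2 -> 0 <= l ->
  (noise n s [set e | (l < \sum_i (tnth e i : R) * a i)%R] <=
   (expR (- (l ^+ 2 / (2 * s ^+ 2 * \sum_i a i ^+ 2))))%:E *
   noise n s [set e | (0 < \sum_i (tnth e i : R) * a i)%R])%E.
Proof.
move=> s0 A0 l0; set A := \sum_i a i ^+ 2.
set B := [set e : n.-tuple _ | 0 < \sum_i (tnth e i : R) * a i].
set Bl := [set e : n.-tuple _ | l < \sum_i (tnth e i : R) * a i].
have mB : measurable B by exact: measurable_half_space.
have mBl : measurable Bl by exact: measurable_half_space.
pose m i := - (l / A) * a i.
have mind (D : set (n.-tuple (measurableTypeR R))) : measurable D ->
    measurable_fun setT (fun e => (\1_D e : R)%:E).
  by move=> mD; apply/measurable_EFinP; exact: measurable_indic.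
have transE e : \1_B (translate_tuple m e) = \1_Bl e :> R.
  have transl : (\sum_i (tnth (translate_tuple m e) i : R) * a i =
      \sum_i (tnth e i : R) * a i - l).
    under eq_bigr do rewrite tnth_mktuple mulrDl /m -mulrA -expr2.
    by rewrite big_split/= -mulr_sumr -/A mulNr divfK// gt_eqF.
  rewrite !indicE; congr (nat_of_bool _)%:R.
  by apply/idP/idP; rewrite !inE /B /Bl /= transl subr_gt0.
have -> : noise n s Bl = (\int[noise n s]_e (\1_B (translate_tuple m e))%:E)%E.
  under eq_integral do rewrite transE.
  by rewrite integral_indic// setIT.
rewrite (noise_translate m (f := fun e => (\1_B e)%:E)) //; last first.
  exact: mind.
rewrite -[in leRHS](setIT B) -integral_indic// -ge0_integralZl//=; last first.
  exact: mind.
apply: ge0_le_integral => //.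
- by move=> e _; rewrite mule_ge0// lee_fin expR_ge0.
- apply: emeasurable_funM; first exact: mind.
  by apply/measurable_EFinP; exact: measurable_shift_density.
- by apply: emeasurable_funM => //; exact: mind.
move=> e _; rewrite indicE; have [|] := boolP (e \in B); last first.
  by rewrite mul0e mule0.
rewrite inE /B /= => e0; rewrite mul1e mule1 lee_fin ler_expR /m.
under eq_bigr do rewrite mulrCA; rewrite -mulr_sumr.
under [X in _ - X / _]eq_bigr do rewrite exprMn; rewrite -mulr_sumr -/A.
have -> : (- (l / A)) ^+ 2 * A / (2 * s ^+ 2) = l ^+ 2 / (2 * s ^+ 2 * A).
  by field; rewrite s0 gt_eqF.
rewrite gerDr !mulNr oppr_le0 divr_ge0 ?sqr_ge0// mulr_ge0 ?(ltW e0)//.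
by rewrite divr_ge0// ltW.
Qed.

(** The two half-spaces of level 0 are disjoint, so their probabilities add up to
    at most 1 and the two-sided bound has no factor 2. *)
Lemma noise_slab n s (a : 'I_n -> R) (l : R) :
  s != 0 -> 0 < \sum_i a i ^+ 2 -> 0 <= l ->
  (noise n s [set e | (l < `|\sum_i (tnth e i : R) * a i|)%R] <=
   (expR (- (l ^+ 2 / (2 * s ^+ 2 * \sum_i a i ^+ 2))))%:E)%E.
Proof.
move=> s0 A0 l0.
pose Up (b : 'I_n -> R) c :=
  [set e : n.-tuple (measurableTypeR R) | c < \sum_i (tnth e i : R) * b i].
have mUp b c : measurable (Up b c) by exact: measurable_half_space.
pose b i := - a i.
have bE e : \sum_i (tnth e i : R) * b i = - \sum_i (tnth e i : R) * a i.
  by rewrite -sumrN; apply: eq_bigr => i _; rewrite mulrN.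
have b2E : \sum_i b i ^+ 2 = \sum_i a i ^+ 2.
  by apply: eq_bigr => i _; rewrite sqrrN.
have -> : [set e : n.-tuple (measurableTypeR R) |
    l < `|\sum_i (tnth e i : R) * a i|] = Up a l `|` Up b l.
  by apply/seteqP; split => e; rewrite /Up /= bE ltr_normr => /orP.
apply: (le_trans (measureU2 _ _ _)) => //.
set c := expR _.
apply: (@le_trans _ _ (c%:E * (noise n s (Up a 0%R) + noise n s (Up b 0%R)))%E).
  rewrite ge0_muleDr// leeD//; first exact: noise_half_space.
  by rewrite /c -b2E; apply: noise_half_space; rewrite ?b2E.
rewrite -measureU//; last first.
  apply/seteqP; split => e //; rewrite /Up /= bE oppr_gt0 => -[e1 e2].
  by have := lt_trans e1 e2; rewrite ltxx.
rewrite -[leRHS]mule1 lee_wpmul2l ?lee_fin ?expR_ge0//.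
exact: probability_le1 (measurableU _ _ (mUp _ _) (mUp _ _)).
Qed.

(** As exp (1/9) >= 10/9, the number (10/9)^9 is a lower bound for e. *)
Lemma expR1_gt : 18 / 7 < expR 1 :> R.
Proof.
have e9 : 10 / 9 <= expR (1 / 9) :> R.
  by apply: le_trans (expR_ge1Dx _); lra.
have -> : (1 : R) = 9%:R * (1 / 9) by field.
rewrite expRM_natl.
apply: (@lt_le_trans _ _ ((10 / 9) ^+ 9)); first by lra.
by rewrite lerXn2r// nnegrE ?expR_ge0//; lra.
Qed.

(** With u = 14/9 L this is pi * 9/14 * u <= exp u, a consequence of
    e u <= exp u and of pi < 4 <= 14/9 * e. *)
Lemma sqrt_pi_mul_le (L : R) : 0 <= L -> Num.sqrt (pi * L) <= expR (7 / 9 * L).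
Proof.
move=> L0; rewrite -[leRHS]ger0_norm ?expR_ge0// -sqrtr_sqr ler_wsqrtr//.
rewrite -expRM_natl mulrA; set u := (X in expR X).
have eu : expR 1 * u <= expR u.
  rewrite -[X in _ <= expR X](subrK 1) expRD mulrC ler_wpM2r ?expR_ge0//.
  by apply: le_trans (expR_ge1Dx _); rewrite addrC subrK.
apply: le_trans eu; rewrite /u mulrA ler_wpM2r//.
have := pihalf_lt2 R; have := expR1_gt; lra.
Qed.

Lemma finite_union_bigsetU (T : Type) (I : finType) (F : I -> set T) :
  [set x | exists i, F i x] = \big[setU/set0]_i F i.
Proof.
rewrite -(bigcup_pred predT).
by apply/seteqP; split => x [i]; [exists i|exists i].
Qed.

Lemma measurable_finite_union d (T : measurableType d) (I : finType)
    (F : I -> set T) :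
  (forall i, measurable (F i)) -> measurable [set x | exists i, F i x].
Proof. by move=> mF; rewrite finite_union_bigsetU; exact: bigsetU_measurable. Qed.

Lemma measure_finite_union_le d (T : measurableType d)
    (mu : {measure set T -> \bar R}) (I : finType) (F : I -> set T) :
  (forall i, measurable (F i)) ->
  (mu [set x | exists i, F i x] <= \sum_i mu (F i))%E.
Proof.
move=> mF; rewrite finite_union_bigsetU.
apply: (proj2 (big_ind2 (fun X x => measurable X /\ (mu X <= x)%E) _ _ _)) => //.
- by rewrite measure0.
- move=> X x Y y [mX Xx] [mY Yy]; split; first exact: measurableU.
  by apply: (le_trans (measureU2 _ _ _)) => //; exact: leeD.
Qed.

(** Each column contributes exp (- 16/9 (1 + k) L) with L = ln p, and there are
    exp L of them: the product is p^-k times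
    exp (- 7/9 (1 + k) L), and the last factor pays for sqrt (pi L). *)
Lemma noise_max_corr n p s (X : 'M[R]_(n, p)) (k : R) :
  (0 < n)%N -> (1 < p)%N -> 0 < s -> 0 <= k ->
  (forall j, \sum_i X i j ^+ 2 = n%:R) ->
  (noise n s [set e | exists j, (4 / 3 * (s * Num.sqrt (2 * n%:R * (1 + k) * ln p%:R))
     < `|\sum_i (tnth e i : R) * X i j|)%R] <=
   (1 / (p%:R `^ k * Num.sqrt (pi * ln p%:R)))%:E)%E.
Proof.
move=> n0 p1 s0 k0 Xn; set L := ln p%:R; set l := 4 / 3 * _.
have L0 : 0 < L by rewrite ln_gt0// ltr1n.
have p0 : 0 < p%:R :> R by rewrite ltr0n (ltn_trans _ p1).
have pE : p%:R = expR L by rewrite lnK// posrE.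
have n0R : 0 < n%:R :> R by rewrite ltr0n.
have l0 : 0 <= l by rewrite !mulr_ge0// ?sqrtr_ge0// ltW.
have l2 : l ^+ 2 = 16 / 9 * s ^+ 2 * (2 * n%:R * (1 + k) * L).
  rewrite !exprMn sqr_sqrtr; first by field.
  by rewrite !mulr_ge0 ?ler0n ?addr_ge0// ltW.
have /le_trans := @measure_finite_union_le _ _ (noise n s) 'I_p
  (fun j e => l < `|\sum_i (tnth e i : R) * X i j|) (fun j => measurable_slab _ _).
apply.
have slabX j : (noise n s [set e | (l < `|\sum_i (tnth e i : R) * X i j|)%R] <=
    (expR (- (16 / 9 * (1 + k) * L)))%:E)%E.
  have := @noise_slab n s (X^~ j) l; rewrite Xn.
  have -> : l ^+ 2 / (2 * s ^+ 2 * n%:R) = 16 / 9 * (1 + k) * L.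
    by rewrite l2; field; rewrite !gt_eqF.
  by apply => //; rewrite gt_eqF.
apply: (le_trans (lee_sum _ (fun j _ => slabX j))).
rewrite sumEFin lee_fin sumr_const card_ord -[leLHS]mulr_natl pE -expRM.
rewrite ler_pdivlMr ?mulr_gt0 ?expR_gt0 ?sqrtr_gt0 ?mulr_gt0 ?pi_gt0//.
apply: (@le_trans _ _ (expR L * expR (- (16 / 9 * (1 + k) * L)) *
    (expR (L * k) * expR (7 / 9 * L)))).
  by rewrite !ler_wpM2l ?mulr_ge0 ?expR_ge0// sqrt_pi_mul_le// ltW.
rewrite -!expRD -[leRHS]expR0 ler_expR.
have -> : L - 16 / 9 * (1 + k) * L + (L * k + 7 / 9 * L) = - (7 / 9 * (k * L)).
  by field.
by rewrite oppr_le0 !mulr_ge0// ltW.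
Qed.

End gaussian_tail.

(** * Integrals and measurability *)

Section integral_misc.
Context d (T : measurableType d) (R : realType) (mu : {measure set T -> \bar R}).

(** The integral of a nonnegative function is a supremum over the simple
    functions below it, hence monotone on arbitrary functions; it is applied to
    the posterior as a function of the noise. *)
Lemma ge0_le_integral_sup (D : set T) (f g : T -> \bar R) :
  (forall x, D x -> 0 <= f x)%E -> (forall x, D x -> f x <= g x)%E ->
  (\int[mu]_(x in D) f x <= \int[mu]_(x in D) g x)%E.
Proof.
move=> f0 fg; have g0 x : D x -> (0 <= g x)%E.
  by move=> Dx; exact: le_trans (f0 _ Dx) (fg _ Dx).
rewrite !ge0_integralE//; apply: le_ereal_sup => _ [h hf <-]; exists h => //= x.
apply: (le_trans (hf x)); rewrite !patchE; case: ifPn => // /set_mem; exact: fg.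
Qed.

(** The degenerate quotients 0 / 0 and x / +oo are both 0. *)
Lemma ediv_le1 (x y : \bar R) : (0 <= x)%E -> (x <= y)%E -> (x / y <= 1)%E.
Proof.
move=> x0 xy; have := le_trans x0 xy; case: y xy => [y xy| |//]; last first.
  by move=> _ _; rewrite invey mule0.
rewrite lee_fin le0r => /predU1P[y0|y0].
  have -> : x = 0%E by apply/eqP; rewrite eq_le x0 andbT; move: xy; rewrite y0.
  by rewrite mul0e.
by rewrite inver gt_eqF// lee_pdivrMr// mul1e.
Qed.
End integral_misc.

Section borel_cV_measurability.
Context {R : realType} (n p : nat) (X : 'M[R]_(n, p)).

Lemma measurable_entry (j : 'I_p) :
  measurable_fun setT (fun b : borel_cV R p => (b : 'cV[R]_p) j 0).
Proof.
apply: (measurability _ (RGenOpens.measurableE R)).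
move=> _ [_ [a [b ->] <-]]; rewrite setTI; apply: sub_sigma_algebra.
have := @coord_continuous R p 1 j 0 => /continuousP; apply.
exact: interval_open.
Qed.

Lemma measurable_l1norm (b0 : 'cV[R]_p) :
  measurable_fun setT (fun b : borel_cV R p => l1norm ((b : 'cV[R]_p) - b0)).
Proof.
apply: measurable_sum => j; apply: measurableT_comp => //.
under eq_fun do rewrite !mxE.
by apply: measurable_funD => //; exact: measurable_entry.
Qed.

Lemma measurable_l2norm (b0 : 'cV[R]_p) :
  measurable_fun setT (fun b : borel_cV R p => l2norm ((b : 'cV[R]_p) - b0)).
Proof.
apply: measurableT_comp.
  by apply: continuous_measurable_fun; exact: sqrt_continuous.
apply: measurable_sum => j; apply: measurable_funX.
under eq_fun do rewrite !mxE.
by apply: measurable_funD => //; exact: measurable_entry.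
Qed.

Lemma measurable_normball (N : 'cV[R]_p -> R) (b0 : 'cV[R]_p) (r : R) :
  measurable_fun setT (fun b : borel_cV R p => N ((b : 'cV[R]_p) - b0)) ->
  measurable (normball N b0 r : set (borel_cV R p)).
Proof.
move=> mN; rewrite (_ : normball N b0 r =
    (fun b : borel_cV R p => N ((b : 'cV[R]_p) - b0)) @^-1` `]-oo, r[%classic).
  by rewrite -[X in measurable X]setTI; exact: mN.
by apply/seteqP; split => b /=; rewrite /normball /= in_itv.
Qed.

(** By [approx_sparseP] the class is a finite union of sets defined by finitely
    many coordinates. *)
Lemma measurable_approx_sparse S (r : R) :
  measurable (approx_sparse S r : set (borel_cV R p)).
Proof.
pose F (T : {set 'I_p}) : set (borel_cV R p) := [set b | (#|T| <= S)%N /\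
  \sum_(i in (~: T)%SET) `|(b : 'cV[R]_p) i 0| <= r].
rewrite (_ : approx_sparse S r = [set b | exists T, F T b]); last first.
  by apply/seteqP; split => b /approx_sparseP.
apply: (measurable_finite_union (F := F)) => T.
have [TS|TS] := boolP (#|T| <= S)%N; last first.
  rewrite (_ : F T = set0)//.
  by apply/seteqP; split => b //; rewrite /F /= (negbTE TS) => -[].
rewrite (_ : F T = (fun b : borel_cV R p =>
    \sum_(i <- enum (~: T)%SET) `|(b : 'cV[R]_p) i 0|) @^-1` `]-oo, r]%classic); last first.
  by apply/seteqP; split => b /=; rewrite /F /= in_itv/= big_enum/=; [case|].
rewrite -[X in measurable X]setTI.
have mF : measurable_fun setT (fun b : borel_cV R p =>
    \sum_(i <- enum (~: T)%SET) `|(b : 'cV[R]_p) i 0|).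
  by apply: measurable_sum => i; apply: measurableT_comp => //; exact: measurable_entry.
exact: mF.
Qed.

Lemma measurable_joint_shift_density s (b0 : 'cV[R]_p) :
  measurable_fun setT (fun eb : n.-tuple (measurableTypeR R) * borel_cV R p =>
    shift_density s (fun i => (X *m ((eb.2 : 'cV[R]_p) - b0)) i 0) eb.1).
Proof.
have mmean i : measurable_fun setT
    (fun eb : n.-tuple (measurableTypeR R) * borel_cV R p =>
      (X *m ((eb.2 : 'cV[R]_p) - b0)) i 0).
  under eq_fun do rewrite mxE.
  apply: measurable_sum => j; apply: measurable_funM => //.
  under eq_fun do rewrite !mxE.
  apply: measurable_funD => //.
  exact: (measurableT_comp (measurable_entry j) measurable_snd).
apply: measurableT_comp => //; apply: measurable_funB => //.
  apply: measurable_funM => //; apply: measurable_sum => i.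
  apply: measurable_funM => //.
  exact: (measurableT_comp (measurable_coord i) measurable_fst).
apply: measurable_funM => //; apply: measurable_sum => i.
exact: measurable_funX.
Qed.

Lemma measurable_shift_density_param s (b0 : 'cV[R]_p) e :
  measurable_fun setT (fun b : borel_cV R p =>
    shift_density s (fun i => (X *m ((b : 'cV[R]_p) - b0)) i 0) e).
Proof.
exact: (measurableT_comp (measurable_joint_shift_density s b0)
  (pair1_measurable e)).
Qed.

End borel_cV_measurability.

(** * Likelihood ratios and the posterior *)

Section posterior.
Context {R : realType} (n p : nat) (X : 'M[R]_(n, p)) (s : R).
Hypothesis s_gt0 : 0 < s.
Hypothesis X_cols : forall j, \sum_i X i j ^+ 2 = n%:R.
Variables (b0 : 'cV[R]_p) (Pi : probability (borel_cV R p) R).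
Implicit Types (e : n.-tuple (measurableTypeR R)) (b : 'cV[R]_p).

Definition noise_vec e : 'cV[R]_n := \col_i (tnth e i : R).

(** The likelihood ratio of b and b0 as a function of the noise, see
    [likelihood_ratio]. *)
Definition lratio b e := shift_density s (fun i => (X *m (b - b0)) i 0) e.

Definition small_corr (l : R) : set (n.-tuple (measurableTypeR R)) :=
  [set e | forall j, `|\sum_i (tnth e i : R) * X i j| <= l].

Lemma likelihood_gt0 y b : 0 < likelihood X s y b.
Proof.
rewrite mulr_gt0 ?expR_gt0// powR_gt0//.
by rewrite mulr_gt0 ?mulr_gt0 ?pi_gt0 ?exprn_gt0.
Qed.

Lemma likelihood_ratio e b :
  likelihood X s (X *m b0 + noise_vec e) b =
  likelihood X s (X *m b0 + noise_vec e) b0 * lratio b e.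
Proof.
rewrite /likelihood /lratio /shift_density -[RHS]mulrA -expRD; congr (_ * expR _).
have -> : X *m b0 + noise_vec e - X *m b = noise_vec e - X *m (b - b0).
  by rewrite mulmxBr opprB [X *m b0 + _]addrC -addrA.
have -> : X *m b0 + noise_vec e - X *m b0 = noise_vec e.
  by rewrite addrC addrA addNr add0r.
set m := X *m (b - b0).
have -> : l2norm (noise_vec e - m) ^+ 2 = l2norm (noise_vec e) ^+ 2 -
    2 * (\sum_i (tnth e i : R) * m i 0) + \sum_i m i 0 ^+ 2.
  rewrite !sqr_l2norm mulr_sumr -sumrB -big_split/=; apply: eq_bigr => i _.
  by rewrite !mxE; ring.
by field; rewrite gt_eqF.
Qed.

Lemma measurable_likelihood y :
  measurable_fun setT (fun b : borel_cV R p => likelihood X s y b).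
Proof.
apply: measurable_funM => //; apply: measurableT_comp => //.
apply: measurableT_comp => //; apply: measurable_funM => //.
under eq_fun do rewrite sqr_l2norm.
apply: measurable_sum => i; apply: measurable_funX.
under eq_fun do rewrite !mxE.
apply: measurable_funB => //; apply: measurable_sum => j.
by apply: measurable_funM => //; exact: measurable_entry.
Qed.

Lemma posterior_ge0 y (U : set 'cV[R]_p) : (0 <= posterior X s Pi y U)%E.
Proof.
rewrite mule_ge0 ?inve_ge0//; apply: integral_ge0 => b _;
  by rewrite lee_fin ltW// likelihood_gt0.
Qed.

Lemma posterior_le1 y (U : set 'cV[R]_p) :
  measurable (U : set (borel_cV R p)) -> (posterior X s Pi y U <= 1)%E.
Proof.
move=> mU; apply: ediv_le1.
  by apply: integral_ge0 => b _; rewrite lee_fin ltW// likelihood_gt0.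
apply: ge0_subset_integral => //.
- by apply/measurable_EFinP; exact: measurable_likelihood.
- by move=> b _; rewrite lee_fin ltW// likelihood_gt0.
Qed.

(** The linear term of the log-likelihood ratio is at most l / s^2 times the l1
    norm of b - b0, that is 8/9 k, and the quadratic term is at most
    n / (2 s^2) times its square, that is 1/9 k. *)
Lemma lratio_lower e (k C : R) b : (0 < n)%N -> 0 <= k ->
  let l := 4 / 3 * (s * Num.sqrt (2 * n%:R * k)) in
  small_corr l e ->
  l1norm (b - b0) < 1 / 3 * Num.sqrt (2 * s ^+ 2 * k / n%:R) ->
  expR (- k) <= lratio b e.
Proof.
move=> n0 k0 l el; set h := b - b0; set rad := 1 / 3 * _ => /ltW hC.
have n0R : 0 < n%:R :> R by rewrite ltr0n.
rewrite ler_expR.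
have corr : - (rad * l) <= \sum_i (tnth e i : R) * (X *m h) i 0.
  rewrite lerNl; apply: (le_trans (ler_norm _)); rewrite normrN.
  have -> : \sum_i (tnth e i : R) * (X *m h) i 0 =
      \sum_j h j 0 * (\sum_i (tnth e i : R) * X i j).
    under eq_bigr do rewrite mxE mulr_sumr.
    rewrite exchange_big/=; apply: eq_bigr => j _; rewrite mulr_sumr.
    by apply: eq_bigr => i _; ring.
  apply: (le_trans (ler_norm_sum _ _ _)).
  have l0 : 0 <= l by rewrite mulr_ge0// mulr_ge0 ?sqrtr_ge0// ltW.
  apply: (@le_trans _ _ (l1norm h * l)); last by rewrite ler_wpM2r.
  by rewrite mulr_suml; apply: ler_sum => j _; rewrite normrM ler_wpM2l.
have norm : \sum_i (X *m h) i 0 ^+ 2 <= n%:R * rad ^+ 2.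
  rewrite -sqr_l2norm; apply: (le_trans (l2norm_mulmx_le_l1norm X_cols h)).
  rewrite ler_wpM2l ?ler0n// ler_sqr ?nnegrE//; first exact: sumr_ge0.
  by rewrite mulr_ge0// sqrtr_ge0.
have rad2 : rad ^+ 2 = 2 / 9 * (s ^+ 2 * k / n%:R).
  rewrite exprMn sqr_sqrtr; first by field; rewrite gt_eqF.
  by rewrite divr_ge0 ?ler0n// !mulr_ge0// ltW.
have radl : rad * l = 8 / 9 * (s ^+ 2 * k).
  have -> : rad * l = 4 / 9 * s * (Num.sqrt (2 * s ^+ 2 * k / n%:R) *
      Num.sqrt (2 * n%:R * k)) by rewrite /rad /l; field.
  rewrite -sqrtrM; last by rewrite divr_ge0 ?ler0n// !mulr_ge0// ltW.
  have -> : 2 * s ^+ 2 * k / n%:R * (2 * n%:R * k) = (2 * s * k) ^+ 2.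
    by field; rewrite gt_eqF.
  rewrite sqrtr_sqr ger0_norm; first by field.
  by rewrite !mulr_ge0// ltW.
apply: (@le_trans _ _ (- (rad * l) / s ^+ 2 - n%:R * rad ^+ 2 / (2 * s ^+ 2))).
  by rewrite rad2 radl le_eqVlt; apply/orP; left; apply/eqP; field; rewrite !gt_eqF.
apply: lerB; first by rewrite ler_wpM2r// invr_ge0 sqr_ge0.
by rewrite ler_wpM2r// invr_ge0 mulr_ge0// sqr_ge0.
Qed.

(** Divide numerator and denominator by the likelihood at b0; the denominator is
    then at least its part over B. *)
Lemma posterior_le_lratio e (U B : set 'cV[R]_p) (c : R) :
  measurable (U : set (borel_cV R p)) -> measurable (B : set (borel_cV R p)) ->
  0 < c -> (0 < Pi B)%E -> (forall b, B b -> c <= lratio b e) ->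
  (posterior X s Pi (X *m b0 + noise_vec e) U <=
   (c^-1 / fine (Pi B))%:E * \int[Pi]_(b in U) (lratio b e)%:E)%E.
Proof.
move=> mU mB c0 PB0 Bc; set y := X *m b0 + noise_vec e.
set f0 := likelihood X s y b0.
have f00 : 0 < f0 by exact: likelihood_gt0.
have likE b : likelihood X s y b = f0 * lratio b e by exact: likelihood_ratio.
clearbody f0 y.
have PBE : Pi B = (fine (Pi B))%:E by rewrite fineK// fin_num_measure.
have q0 : 0 < fine (Pi B) by rewrite -lte_fin -PBE.
have mlr : measurable_fun setT (fun b : borel_cV R p => (lratio b e)%:E).
  by apply/measurable_EFinP; exact: measurable_shift_density_param.
have lr0 b : (0 <= (lratio b e)%:E)%E by rewrite lee_fin expR_ge0.
have num : (\int[Pi]_(b in U) (likelihood X s y b)%:E =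
    f0%:E * \int[Pi]_(b in U) (lratio b e)%:E)%E.
  rewrite -ge0_integralZl//; first by apply: eq_integral => b _; rewrite likE.
  - exact: measurable_funTS.
  - by rewrite lee_fin ltW.
have den : ((f0 * c * fine (Pi B))%:E <= \int[Pi]_b (likelihood X s y b)%:E)%E.
  rewrite EFinM -PBE -integral_cst//.
  apply: (@le_trans _ _ (\int[Pi]_(b in B) (likelihood X s y b)%:E)%E).
    apply: ge0_le_integral_sup => b Bb; first by rewrite lee_fin mulr_ge0// ltW.
    by rewrite likE lee_fin ler_pM2l// Bc.
  apply: ge0_subset_integral => //.
  - by apply/measurable_EFinP; exact: measurable_likelihood.
  - by move=> b _; rewrite lee_fin ltW// likelihood_gt0.
have K0 : 0 < f0 * c * fine (Pi B) by rewrite mulr_gt0// mulr_gt0.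
apply: (@le_trans _ _ (\int[Pi]_(b in U) (likelihood X s y b)%:E *
    ((f0 * c * fine (Pi B))^-1)%:E)%E).
  rewrite lee_wpmul2l//.
    by apply: integral_ge0 => b _; rewrite lee_fin ltW// likelihood_gt0.
  have -> : ((f0 * c * fine (Pi B))^-1)%:E = ((f0 * c * fine (Pi B))%:E^-1)%E.
    by rewrite inver gt_eqF.
  rewrite lee_pV2// inE; first exact: le_trans (ltW _) den.
  by rewrite lee_fin ltW.
rewrite num muleC muleA -EFinM le_eqVlt; apply/orP; left; apply/eqP.
by congr (_%:E * _)%E; field; rewrite !gt_eqF.
Qed.

End posterior.

Section expected_posterior.
Context {R : realType} (n p : nat) (X : 'M[R]_(n, p)) (s : R).
Hypothesis s_gt0 : 0 < s.
Variables (b0 : 'cV[R]_p) (Pi : probability (borel_cV R p) R).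
Implicit Types (e : n.-tuple (measurableTypeR R)) (b : 'cV[R]_p).

Let mean b := fun i => (X *m (b - b0)) i 0.

Lemma measurable_small_corr l : measurable (small_corr X l).
Proof.
rewrite (_ : small_corr X l = ~` [set e | exists j,
    l < `|\sum_i (tnth e i : R) * X i j|]).
  by apply: measurableC; apply: measurable_finite_union => j; exact: measurable_slab.
apply/seteqP; split => e /=.
  by move=> el [j]; rewrite ltNge el.
by move=> el j; rewrite leNgt; apply/negP => lt; apply: el; exists j.
Qed.

Lemma measurable_integral_lratio (U : set 'cV[R]_p) :
  measurable (U : set (borel_cV R p)) ->
  measurable_fun setT
    (fun e => \int[Pi]_(b in U) (lratio X s b0 b e)%:E)%E.
Proof.
move=> mU.
rewrite (_ : (fun e => _) = fubini_F Pi
    (fun eb : n.-tuple (measurableTypeR R) * borel_cV R p =>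
      (lratio X s b0 eb.2 eb.1)%:E * (\1_U eb.2)%:E)%E); last first.
  apply/funext => e; rewrite integral_mkcond; apply: eq_integral => b _.
  by rewrite epatch_indic.
apply: measurable_fun_fubini_tonelli_F => [|eb].
  apply: emeasurable_funM; apply/measurable_EFinP.
    exact: measurable_joint_shift_density.
  apply: (measurableT_comp _ measurable_snd).
  exact: measurable_indic mU.
by rewrite mule_ge0// lee_fin ?expR_ge0.
Qed.

(** Tonelli's theorem and the change of measure: averaging the likelihood ratio
    of b over the noise amounts to moving the noise by the difference of means. *)
Lemma expected_lratio (E : set (n.-tuple (measurableTypeR R))) (U : set 'cV[R]_p) :
  measurable E -> measurable (U : set (borel_cV R p)) ->
  (\int[noise n s]_e ((\1_E e)%:E * \int[Pi]_(b in U) (lratio X s b0 b e)%:E) =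
   \int[Pi]_(b in U) noise n s (translate_tuple (mean b) @^-1` E))%E.
Proof.
move=> mE mU.
have lr0 b e : (0 <= (lratio X s b0 b e)%:E)%E by rewrite lee_fin expR_ge0.
have mlr e : measurable_fun setT (fun b : borel_cV R p => (lratio X s b0 b e)%:E).
  by apply/measurable_EFinP; exact: measurable_shift_density_param.
have m1E : measurable_fun setT (fun e => (\1_E e : R)%:E).
  by apply/measurable_EFinP; exact: measurable_indic.
have m1U : measurable_fun setT (fun b : borel_cV R p => (\1_U b : R)%:E).
  by apply/measurable_EFinP; exact: measurable_indic.
have ind0 (T : Type) (A : set T) x : (0 <= (\1_A x : R)%:E)%E by rewrite lee_fin.
pose F (eb : n.-tuple (measurableTypeR R) * borel_cV R p) :=
  ((\1_E eb.1)%:E * ((lratio X s b0 eb.2 eb.1)%:E * (\1_U eb.2)%:E))%E.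
transitivity (\int[noise n s]_e \int[Pi]_b F (e, b))%E.
  apply: eq_integral => e _; rewrite integral_mkcond -ge0_integralZl//=.
  - by apply: eq_integral => b _; rewrite epatch_indic.
  - apply: (proj1 (measurable_restrictT _ mU)); exact: measurable_funTS (mlr e).
  - by move=> b _; rewrite erestrict_ge0.
rewrite fubini_tonelli/=; last 2 first.
- apply: emeasurable_funM; first exact: (measurableT_comp m1E measurable_fst).
  apply: emeasurable_funM; last exact: (measurableT_comp m1U measurable_snd).
  by apply/measurable_EFinP; exact: measurable_joint_shift_density.
- by move=> [e b]; rewrite !mule_ge0.
rewrite [RHS]integral_mkcond; apply: eq_integral => b _.
rewrite epatch_indic muleC.
transitivity (\int[noise n s]_e ((\1_U b)%:E * ((\1_E e)%:E * (lratio X s b0 b e)%:E)))%E.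
  by apply: eq_integral => e _; rewrite /F/= muleA muleC.
have mlre : measurable_fun setT (fun e => (lratio X s b0 b e)%:E).
  by apply/measurable_EFinP; exact: measurable_shift_density.
rewrite ge0_integralZl//=; last 2 first.
- exact: emeasurable_funM.
- by move=> e _; rewrite mule_ge0.
congr (_ * _)%E; rewrite -(noise_translate (mean b) (f := fun e => (\1_E e)%:E))//; last first.
  by rewrite gt_eqF.
have mpre : measurable (translate_tuple (mean b) @^-1` E).
  by rewrite -[X in measurable X]setTI; exact: measurable_translate_tuple.
by rewrite -[X in noise n s X]setIT -integral_indic.
Qed.

(** Bound the posterior by 1 when the noise has a large correlation, and by
    [posterior_le_lratio] otherwise; then split the prior integral according to
    P. *)
Theorem expected_posterior_le (l c t : R) (U B P : set 'cV[R]_p) :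
  measurable (U : set (borel_cV R p)) -> measurable (B : set (borel_cV R p)) ->
  measurable (P : set (borel_cV R p)) ->
  0 < c -> (0 < Pi B)%E -> 0 <= t ->
  (forall e b, small_corr X l e -> B b -> c <= lratio X s b0 b e) ->
  (forall b, U b -> P b ->
    (noise n s (translate_tuple (mean b) @^-1` small_corr X l) <= t%:E)%E) ->
  (model_expectation X s b0 (fun y => posterior X s Pi y U) <=
   noise n s (~` small_corr X l) +
   (c^-1 / fine (Pi B))%:E * (Pi (U `\` P) + t%:E))%E.
Proof.
move=> mU mB mP c0 PB0 t0 Bc Ut; set E := small_corr X l.
have mE : measurable E by exact: measurable_small_corr.
have k0 : 0 <= c^-1 / fine (Pi B) by rewrite divr_ge0 ?fine_ge0// invr_ge0 ltW.
set k := c^-1 / _ in k0 *.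
pose L e := (\int[Pi]_(b in U) (lratio X s b0 b e)%:E)%E.
have L0 e : (0 <= L e)%E by apply: integral_ge0 => b _; rewrite lee_fin expR_ge0.
have ind0 (T : Type) (A : set T) x : (0 <= (\1_A x : R)%:E)%E by rewrite lee_fin.
have m1 (A : set (n.-tuple (measurableTypeR R))) : measurable A ->
    measurable_fun setT (fun e => (\1_A e : R)%:E).
  by move=> mA; apply/measurable_EFinP; exact: measurable_indic.
have mL : measurable_fun setT L.
  exact: measurable_integral_lratio.
rewrite /model_expectation -/(noise n s).
apply: (@le_trans _ _ (\int[noise n s]_e
    ((\1_(~` E) e)%:E + k%:E * ((\1_E e)%:E * L e)))%E).
  apply: ge0_le_integral_sup => e _; first exact: posterior_ge0.
  have [eE|eE] := pselect (E e).
    rewrite !indicE (mem_set eE) memNset ?mul1e ?add0e; last by move=> /(_ eE).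
    apply: posterior_le_lratio => //; by move=> b Bb; exact: Bc.
  rewrite !indicE (memNset eE) mem_set ?mul0e ?mule0 ?adde0//.
  exact: posterior_le1.
rewrite ge0_integralD//=; last 3 first.
- by apply: m1; exact: measurableC.
- by move=> e _; rewrite !mule_ge0.
- by apply: emeasurable_funM => //; apply: emeasurable_funM => //; exact: m1.
rewrite integral_indic ?setIT//; last exact: measurableC.
rewrite leeD2l// ge0_integralZl//=; last 2 first.
- by apply: emeasurable_funM => //; exact: m1.
- by move=> e _; rewrite mule_ge0.
rewrite lee_wpmul2l// expected_lratio//.
apply: (@le_trans _ _ (\int[Pi]_(b in U) ((\1_(U `\` P) b)%:E + t%:E))%E).
  apply: ge0_le_integral_sup => b Ub; first exact: measure_ge0.
  have [Pb|Pb] := pselect (P b).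
    by apply: (le_trans (Ut b Ub Pb)); rewrite leeDr.
  rewrite indicE mem_set//; apply: (@le_trans _ _ 1%E).
    apply: probability_le1; rewrite -[X in measurable X]setTI.
    exact: measurable_translate_tuple.
  by rewrite leeDl// lee_fin.
have mUP : measurable (U `\` P : set (borel_cV R p)) by exact: measurableD.
rewrite ge0_integralD//=; last first.
  by apply/measurable_EFinP/measurable_funTS; exact: measurable_indic.
rewrite integral_indic// integral_cst//; apply: leeD.
  by rewrite le_measure ?inE//; exact: measurableI.
by rewrite -[leRHS]mule1 lee_wpmul2l ?lee_fin//; exact: probability_le1.
Qed.

End expected_posterior.

(** * Posterior concentration *)

Theorem theorem3p1 (R : realType) (n p S : nat)
    (n_gt0 : (0 < n)%N) (S_gt0 : (0 < S)%N) (S_le_p : (S <= p)%N)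
    (p_ge2 : (2 <= p)%N)
    (r sigma : R) (r_ge0 : 0 <= r) (sigma_gt0 : 0 < sigma)
    (X : 'M[R]_(n, p))
    (X_cols : forall i : 'I_p, l2norm (col i X) ^+ 2 = n%:R)
    (beta0 : 'cV[R]_p)
    (beta0_sparse : approx_sparse S r beta0)
    (Pi : probability (borel_cV R p) R)
    (alpha tau : R) (alpha_gt0 : 0 < alpha) (tau_gt0 : 0 < tau)
    (tau1_gt0 : 0 < 1 + tau) (tau1_lt_alpha : 1 + tau < alpha) :
  let Xt := (Num.sqrt n%:R)^-1 *: X in
  let delta := RIC (2 * S) Xt in
  let theta := ROC S (2 * S) Xt in
  let logp : R := ln p%:R in
  let P := approx_sparse S r in
  let eps := 8 * sigma / (1 - delta - theta)
               * Num.sqrt ((1 + alpha) * S%:R * logp / n%:R)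
             + 2 * ((1 - delta + theta) / (1 - delta - theta))
               * (r / Num.sqrt S%:R) in
  let C := 1 / 3 * Num.sqrt (2 * sigma ^+ 2 * (1 + tau) * logp / n%:R) in
  let farset : set 'cV[R]_p := ~` normball (@l2norm R p) beta0 (2 * eps) in
  let prior_near := Pi (normball (@l1norm R p) beta0 C) in
  delta + theta < 1 ->
  (model_expectation X sigma beta0
     (fun y => posterior X sigma Pi y farset)
   <= if prior_near == 0 then +oo else
      (1 / (p%:R `^ alpha * Num.sqrt (pi * logp)))%:E
      + (p%:R `^ (1 + tau))%:E * Pi (farset `\` P) / prior_near
      + (p%:R `^ (1 + tau))%:E
          / ((p%:R `^ alpha * Num.sqrt (pi * logp))%:E * prior_near)
      + (1 / (p%:R `^ tau * Num.sqrt (pi * logp)))%:E)%E.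
Proof.
move=> Xt delta theta logp P eps C farset near RIP.
have [_|near0] := eqVneq near 0%E; first exact: leey.
have p0 : 0 < p%:R :> R by rewrite ltr0n (ltn_trans _ p_ge2).
have logp0 : 0 < logp by rewrite ln_gt0// ltr1n.
have Xc j : \sum_i X i j ^+ 2 = n%:R.
  by rewrite -(X_cols j) sqr_l2norm; apply: eq_bigr => i _; rewrite mxE.
have mfar : measurable (farset : set (borel_cV R p)).
  by apply: measurableC; apply: measurable_normball; exact: measurable_l2norm.
have mball : measurable (normball (@l1norm R p) beta0 C : set (borel_cV R p)).
  by apply: measurable_normball; exact: measurable_l1norm.
have nearE : near = (fine near)%:E by rewrite fineK// fin_num_measure.
have near_gt0 : (0 < near)%E by rewrite lt0e near0 measure_ge0.
have q0 : 0 < fine near by rewrite -lte_fin -nearE.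
have mP : measurable (P : set (borel_cV R p)) by exact: measurable_approx_sparse.
pose tail k := 1 / (p%:R `^ k * Num.sqrt (pi * logp)).
pose lam k := 4 / 3 * (sigma * Num.sqrt (2 * n%:R * (1 + k) * logp)).
have corr_tail k : 0 <= k ->
    (noise n sigma (~` small_corr X (lam k)) <= (tail k)%:E)%E.
  move=> k0; rewrite (_ : ~` _ = [set e | exists j,
      lam k < `|\sum_i (tnth e i : R) * X i j|]); first exact: noise_max_corr.
  apply/seteqP; split => e /=.
    by move=> /existsNP[j /negP]; rewrite -ltNge; exists j.
  by move=> [j lt] /(_ j); rewrite leNgt lt.
have tail0 k : 0 <= tail k.
  by rewrite divr_ge0// mulr_ge0 ?powR_ge0 ?sqrtr_ge0.
have lam_le : lam tau <= lam alpha.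
  rewrite !ler_wpM2l ?(ltW sigma_gt0)// ler_wsqrtr// ler_wpM2r ?(ltW logp0)//.
  rewrite ler_wpM2l ?mulr_ge0// lerD2l ltW// (lt_trans _ tau1_lt_alpha)//.
  by rewrite ltrDr.
have lower e b : small_corr X (lam tau) e -> normball (@l1norm R p) beta0 C b ->
    expR (- ((1 + tau) * logp)) <= lratio X sigma beta0 b e.
  move=> eE bB; apply: lratio_lower => //.
  - by rewrite mulr_ge0 ?ltW.
  - by move: eE; rewrite /lam -!mulrA.
  - by move: bB; rewrite /normball/= /C -!mulrA.
pose shift (b : 'cV[R]_p) := fun i => (X *m (b - beta0)) i 0.
have far_tail b : farset b -> P b ->
    (noise n sigma (translate_tuple (shift b) @^-1`
       small_corr X (lam tau)) <= (tail alpha)%:E)%E.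
  move=> bfar bP; apply: le_trans (corr_tail alpha (ltW alpha_gt0)).
  have msc l : measurable (small_corr X l) by exact: measurable_small_corr.
  rewrite le_measure ?inE//.
  - by rewrite -[X in measurable X]setTI; exact: measurable_translate_tuple.
  - exact: measurableC.
  (* the correlations of X (b - beta0) are the difference of two small ones *)
  move=> e /= shifted orig; apply: bfar; rewrite /normball/=.
  apply: sparse_diff_close => // j.
  have -> : (X^T *m (X *m (b - beta0))) j 0 =
      \sum_i (tnth (translate_tuple (shift b) e) i : R) * X i j
      - \sum_i (tnth e i : R) * X i j.
    rewrite -sumrB mxE; apply: eq_bigr => i _.
    by rewrite tnth_mktuple [X^T _ _]mxE /shift; ring.
  apply: (le_trans (ler_normB _ _)).
  have := le_trans (shifted j) lam_le; have := orig j.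
  rewrite /lam -/logp; lra.
have := expected_posterior_le sigma_gt0 mfar mball mP (expR_gt0 _)
  near_gt0 (tail0 alpha) lower far_tail.
move=> /le_trans; apply.
have powE : p%:R `^ (1 + tau) = expR ((1 + tau) * logp).
  by rewrite /powR gt_eqF.
have farE : Pi (farset `\` P) = (fine (Pi (farset `\` P)))%:E.
  by rewrite fineK// fin_num_measure//; exact: measurableD.
set d := fine _ in farE.
rewrite -/near expRN invrK -powE nearE farE /=.
set a := p%:R `^ (1 + tau).
have tail_alpha : tail alpha = 1 / (p%:R `^ alpha * Num.sqrt (pi * logp)) by [].
have w0 : 0 < p%:R `^ alpha * Num.sqrt (pi * logp).
  by rewrite mulr_gt0 ?powR_gt0// sqrtr_gt0 mulr_gt0 ?pi_gt0.
set w := p%:R `^ alpha * _ in tail_alpha w0 *.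
rewrite -!EFinM !inver (gt_eqF q0) (gt_eqF (mulr_gt0 w0 q0)) -!EFinM -!EFinD.
apply: (le_trans (leeD2r _ (corr_tail tau (ltW tau_gt0)))).
rewrite -EFinD lee_fin -/(tail tau) tail_alpha.
rewrite -subr_ge0 (_ : _ - _ = 1 / w) ?divr_ge0 ?(ltW w0)//.
by field; rewrite !gt_eqF.
Qed.
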